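(* Let $X:I\times J\to\mathbb{S}^3$, $X(s,t)=\alpha(s)\cdot\beta(t)$, be a translation surface of constant mean curvature, where $\alpha,\beta$ are arc length curves in $\mathbb{S}^3$. If $\langle T_\alpha,T_\beta\rangle=C\in(-1,1)$ is constant, or $\kappa_\alpha=0$ (symmetrically, $\kappa_\beta=0$), then this surface is a CMC Clifford torus.
   Context: $\mathbb{R}^4$ is identified with the quaternions, ''$\cdot$'' is quaternion multiplication, $\overline{x}$ is conjugation, $\langle\cdot,\cdot\rangle$ is the Euclidean inner product, and $\mathbb{S}^3$ is the group of unit quaternions with the induced metric. A translation surface is a regular surface locally parametrized by $X(s,t)=\alpha(s)\cdot\beta(t)$. For an arc length curve $\gamma$ in $\mathbb{S}^3$, $\kappa_\gamma=|\nabla_{\gamma'}\gamma'|$ with $\nabla$ the Levi-Civita connection of $\mathbb{S}^3$; $\kappa_\gamma=0$ means identically zero. $T_\alpha=\overline{\alpha}\cdot\alpha'$ and $T_\beta=\beta\cdot\overline{\beta'}$. A Clifford torus is $C_{R_1,R_2}=\{x\in\mathbb{R}^4: x_1^2+x_2^2=R_1^2,\ x_3^2+x_4^2=R_2^2\}$ with $R_1,R_2>0$, $R_1^2+R_2^2=1$, up to isometries of $\mathbb{S}^3$. The statement that a parametrized surface ''is a Clifford torus'' is local: its image lies in a Clifford torus as an open piece. CMC means constant mean curvature (including zero). *)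

(* Defs.v *)
From Stdlib Require Import Reals.
From Coquelicot Require Import Coquelicot.
Open Scope R_scope.

(** R^4 as the quaternions: [(x1, x2, x3, x4)] is [x1 + x2 i + x3 j + x4 k].
    The vector space operations and the topology are those that Coquelicot puts
    on products. *)

Definition quat : Type := (R * R * R * R)%type.

Definition x1 (q : quat) : R := fst (fst (fst q)).
Definition x2 (q : quat) : R := snd (fst (fst q)).
Definition x3 (q : quat) : R := snd (fst q).
Definition x4 (q : quat) : R := snd q.

Definition qmul (p q : quat) : quat :=
  (x1 p * x1 q - x2 p * x2 q - x3 p * x3 q - x4 p * x4 q,
   x1 p * x2 q + x2 p * x1 q + x3 p * x4 q - x4 p * x3 q,
   x1 p * x3 q - x2 p * x4 q + x3 p * x1 q + x4 p * x2 q,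
   x1 p * x4 q + x2 p * x3 q - x3 p * x2 q + x4 p * x1 q).

Definition qconj (q : quat) : quat := (x1 q, - x2 q, - x3 q, - x4 q).

Definition qdot (p q : quat) : R :=
  x1 p * x1 q + x2 p * x2 q + x3 p * x3 q + x4 p * x4 q.

Definition qnorm (q : quat) : R := sqrt (qdot q q).

Definition S3 (q : quat) : Prop := qnorm q = 1.

(** Vector product of three vectors of R^4:
    [qdot (vprod u v w) z = det (u, v, w, z)] for every [z]. *)

Definition det3 (a1 a2 a3 b1 b2 b3 c1 c2 c3 : R) : R :=
  a1 * (b2 * c3 - b3 * c2) - a2 * (b1 * c3 - b3 * c1)
  + a3 * (b1 * c2 - b2 * c1).

Definition vprod (u v w : quat) : quat :=
  (- det3 (x2 u) (x3 u) (x4 u) (x2 v) (x3 v) (x4 v) (x2 w) (x3 w) (x4 w),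
   det3 (x1 u) (x3 u) (x4 u) (x1 v) (x3 v) (x4 v) (x1 w) (x3 w) (x4 w),
   - det3 (x1 u) (x2 u) (x4 u) (x1 v) (x2 v) (x4 v) (x1 w) (x2 w) (x4 w),
   det3 (x1 u) (x2 u) (x3 u) (x1 v) (x2 v) (x3 v) (x1 w) (x2 w) (x3 w)).

Definition ointerval (a b : Rbar) (s : R) : Prop := Rbar_lt a s /\ Rbar_lt s b.

Definition qderive (g : R -> quat) (s : R) : quat :=
  (Derive (fun u => x1 (g u)) s, Derive (fun u => x2 (g u)) s,
   Derive (fun u => x3 (g u)) s, Derive (fun u => x4 (g u)) s).

Definition smooth_on (I : R -> Prop) (g : R -> quat) : Prop :=
  forall (n : nat) (s : R), I s ->
    ex_derive_n (fun u => x1 (g u)) n s /\ ex_derive_n (fun u => x2 (g u)) n s /\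
    ex_derive_n (fun u => x3 (g u)) n s /\ ex_derive_n (fun u => x4 (g u)) n s.

Definition arc_length_curve (I : R -> Prop) (g : R -> quat) : Prop :=
  smooth_on I g /\
  forall s : R, I s -> S3 (g s) /\ qnorm (qderive g s) = 1.

(** Orthogonal projection onto the tangent space of the sphere at [p].  The
    Levi-Civita connection of S^3 is the derivative of R^4 followed by it. *)

Definition tan_proj (p v : quat) : quat := minus v (scal (qdot v p) p).

Definition kappa (g : R -> quat) (s : R) : R :=
  qnorm (tan_proj (g s) (qderive (qderive g) s)).

Definition Tleft (alpha : R -> quat) (s : R) : quat :=
  qmul (qconj (alpha s)) (qderive alpha s).

Definition Tright (beta : R -> quat) (t : R) : quat :=
  qmul (beta t) (qconj (qderive beta t)).

Definition translation (alpha beta : R -> quat) (s t : R) : quat :=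
  qmul (alpha s) (beta t).

(** Parametrized surfaces in S^3 *)

Definition d_s (X : R -> R -> quat) (s t : R) : quat :=
  qderive (fun u => X u t) s.

Definition d_t (X : R -> R -> quat) (s t : R) : quat :=
  qderive (fun v => X s v) t.

Definition regular_on (I J : R -> Prop) (X : R -> R -> quat) : Prop :=
  forall s t : R, I s -> J t ->
  forall a b : R, plus (scal a (d_s X s t)) (scal b (d_t X s t)) = zero ->
    a = 0 /\ b = 0.

Definition unit_normal (X : R -> R -> quat) (s t : R) : quat :=
  let v := vprod (X s t) (d_s X s t) (d_t X s t) in scal (/ qnorm v) v.

(** With first fundamental form [E, F, G] and second fundamental form
    [l, m, n], [H = (l G - 2 m F + n E) / (2 (E G - F^2))]. *)

Definition mean_curvature (X : R -> R -> quat) (s t : R) : R :=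
  let E := qdot (d_s X s t) (d_s X s t) in
  let F := qdot (d_s X s t) (d_t X s t) in
  let G := qdot (d_t X s t) (d_t X s t) in
  let N := unit_normal X s t in
  let l := qdot (tan_proj (X s t) (d_s (d_s X) s t)) N in
  let m := qdot (tan_proj (X s t) (d_t (d_s X) s t)) N in
  let n := qdot (tan_proj (X s t) (d_t (d_t X) s t)) N in
  (l * G - 2 * m * F + n * E) / (2 * (E * G - F ^ 2)).

Definition constant_mean_curvature (I J : R -> Prop) (X : R -> R -> quat) : Prop :=
  exists H : R, forall s t : R, I s -> J t -> mean_curvature X s t = H.

(** Clifford tori *)

Definition sphere_dist (p q : quat) : R := acos (qdot p q).

Definition isometry_S3 (phi : quat -> quat) : Prop :=
  (forall p, S3 p -> S3 (phi p)) /\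
  (forall q, S3 q -> exists p, S3 p /\ phi p = q) /\
  (forall p q, S3 p -> S3 q -> sphere_dist (phi p) (phi q) = sphere_dist p q).

Definition standard_torus (R1 R2 : R) (x : quat) : Prop :=
  x1 x ^ 2 + x2 x ^ 2 = R1 ^ 2 /\ x3 x ^ 2 + x4 x ^ 2 = R2 ^ 2.

Definition clifford_torus (S : quat -> Prop) : Prop :=
  exists (R1 R2 : R) (phi : quat -> quat),
    0 < R1 /\ 0 < R2 /\ R1 ^ 2 + R2 ^ 2 = 1 /\ isometry_S3 phi /\
    forall x, S x <-> exists y, standard_torus R1 R2 y /\ phi y = x.

Definition surface_image (I J : R -> Prop) (X : R -> R -> quat) (x : quat) : Prop :=
  exists s t : R, I s /\ J t /\ X s t = x.

Definition open_piece (P S : quat -> Prop) : Prop :=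
  exists U : quat -> Prop, open U /\ forall x, P x <-> U x /\ S x.

Definition is_clifford_torus (I J : R -> Prop) (X : R -> R -> quat) : Prop :=
  exists S : quat -> Prop, clifford_torus S /\ open_piece (surface_image I J X) S.

(* Main.v *)
(** Write [T = conj alpha * alpha'] and [S = beta * conj beta'].  Both are curves
    of unit imaginary quaternions, and the mean curvature at [(s, t)] depends only
    on [T], [S], [T'], [S'].  If [<T, S>] is constant and [T'] does not vanish
    somewhere, then [S'] is orthogonal to [T], [T'] and [S], which forces
    [S' = 0].  So in every case one of the curves is a geodesic, and conjugation,
    which exchanges their roles, allows to take [alpha].  After an isometry
    [T = i], so that the surface is the preimage of a curve [p] under the Hopf
    fibration [x |-> conj x * i * x].  Constant mean curvature then says that [p]
    has constant geodesic curvature, that is, runs on a circle, and the preimage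
    of a circle is a Clifford torus.  The image is open in it because [p] is
    regular, and covers arcs of the circle by the intermediate value theorem. *)

Require Import Defs.
From Stdlib Require Import Reals Lra Classical.
From Coquelicot Require Import Coquelicot.
Open Scope R_scope.

(** * Quaternions *)

(** Two classical facts are replaced by direct arguments. The geometry at [X(s,t)] is carried to the
    identity by the isometry [u |-> f(s) u g(t)], so that fundamental forms become dot and cross
    products of imaginary quaternions. That a spherical curve of constant geodesic curvature runs on
    a circle is not obtained from uniqueness for an ODE: a vector with the direction of the axis of
    the circle is written down explicitly and its derivative is shown to vanish. Its length
    [sqrt (1 + h^2)] and its component [- h] along the curve give the height
    [C = - h / sqrt (1 + h^2)] of the circle, hence the squared radii [(1 + C) / 2] and
    [(1 - C) / 2] of the torus. The delicate point is openness of the image. The parameter intervals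
    are arbitrary and the parametrization may overlap itself, so the argument is pointwise: every
    point of the torus close to a given image point has to be hit by parameters close to the given
    ones. *)

Definition qone : quat := (1, 0, 0, 0).
Definition qi : quat := (0, 1, 0, 0).
Definition qadd (p q : quat) : quat :=
  (x1 p + x1 q, x2 p + x2 q, x3 p + x3 q, x4 p + x4 q).
Definition qsc (k : R) (p : quat) : quat :=
  (k * x1 p, k * x2 p, k * x3 p, k * x4 p).
Definition qsub (p q : quat) : quat :=
  (x1 p - x1 q, x2 p - x2 q, x3 p - x3 q, x4 p - x4 q).

Ltac qcbn :=
  cbv [qmul qconj qdot qone qi qadd qsub qsc vprod det3 x1 x2 x3 x4 fst snd] in *.
Ltac qdestr :=
  repeat match goal with
  | q : quat |- _ => destruct q as [[[? ?] ?] ?]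
  end.
Ltac qsplit := repeat match goal with |- (_, _) = (_, _) => apply f_equal2 end.
Ltac qring :=
  intros; qdestr;
  cbv [qmul qconj qdot qone qi qadd qsub qsc vprod det3 x1 x2 x3 x4 fst snd];
  qsplit; ring.

Lemma quat_ext p q :
  x1 p = x1 q -> x2 p = x2 q -> x3 p = x3 q -> x4 p = x4 q -> p = q.
Proof. qdestr; qcbn; intros; subst; reflexivity. Qed.

Lemma plus_qadd (p q : quat) : plus p q = qadd p q.
Proof. reflexivity. Qed.

Lemma scal_qsc k (p : quat) : scal k p = qsc k p.
Proof. reflexivity. Qed.

Lemma minus_qsub (p q : quat) : minus p q = qsub p q.
Proof. reflexivity. Qed.

Lemma qmul_assoc p q r : qmul p (qmul q r) = qmul (qmul p q) r.
Proof. qring. Qed.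

Lemma qmul_1l p : qmul qone p = p.
Proof. qring. Qed.

Lemma qmul_1r p : qmul p qone = p.
Proof. qring. Qed.

Lemma qconj_mul p q : qconj (qmul p q) = qmul (qconj q) (qconj p).
Proof. qring. Qed.

Lemma qconj_conj p : qconj (qconj p) = p.
Proof. qring. Qed.

Lemma qconj_mull p : qmul (qconj p) p = qsc (qdot p p) qone.
Proof. qring. Qed.

Lemma qconj_mulr p : qmul p (qconj p) = qsc (qdot p p) qone.
Proof. qring. Qed.

Lemma qsc_1 p : qsc 1 p = p.
Proof. qring. Qed.

Lemma unit_mull p : qdot p p = 1 -> qmul (qconj p) p = qone.
Proof. intros H. rewrite qconj_mull, H. apply qsc_1. Qed.

Lemma unit_mulr p : qdot p p = 1 -> qmul p (qconj p) = qone.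
Proof. intros H. rewrite qconj_mulr, H. apply qsc_1. Qed.

Lemma qdot_mull p q r : qdot (qmul p q) (qmul p r) = qdot p p * qdot q r.
Proof. qring. Qed.

Lemma qdot_mulr p q r : qdot (qmul q p) (qmul r p) = qdot p p * qdot q r.
Proof. qring. Qed.

Lemma qdot_conj p q : qdot (qconj p) (qconj q) = qdot p q.
Proof. qring. Qed.

Lemma qdot_comm p q : qdot p q = qdot q p.
Proof. qring. Qed.

(** Multiplication by [p] is [|p|] times an orientation preserving isometry and [vprod] is
    trilinear, which accounts for the factor [|p|^2]. *)
Lemma vprod_mull p u v w :
  vprod (qmul p u) (qmul p v) (qmul p w) = qsc (qdot p p) (qmul p (vprod u v w)).
Proof. qring. Qed.

Lemma vprod_mulr p u v w :
  vprod (qmul u p) (qmul v p) (qmul w p) = qsc (qdot p p) (qmul (vprod u v w) p).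
Proof. qring. Qed.

Lemma qdot_ge_0 p : 0 <= qdot p p.
Proof. unfold qdot; nra. Qed.

Lemma qdot_0 p : qdot p p = 0 -> p = (0, 0, 0, 0).
Proof.
qdestr; qcbn; intros; qsplit; nra.
Qed.

Lemma qnorm_1 p : qnorm p = 1 <-> qdot p p = 1.
Proof.
unfold qnorm; split; intros H.
- rewrite <- (sqrt_sqrt (qdot p p)), H; [ring|]. unfold qdot; nra.
- rewrite H; apply sqrt_1.
Qed.

(** Since [u^2 = i^2 = -1], both [u (u + i)] and [(u + i) i] equal [u i - 1], so [a] is [u + i]
    normalized. For [u = - i] this sum vanishes and [j] does the job. *)
Lemma conj_to_i u : x1 u = 0 -> qdot u u = 1 ->
  exists a, qdot a a = 1 /\ qmul u a = qmul a qi.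
Proof.
destruct u as [[[u1 u2] u3] u4]; unfold qdot; cbn [x1 x2 x3 x4 fst snd].
intros -> H1.
destruct (Req_dec u2 (-1)) as [->|H2].
- exists (0, 0, 1, 0); split; [qcbn; ring|].
  assert (u3 = 0 /\ u4 = 0) as [-> ->] by nra.
  qring.
- assert (Hp : 0 < 2 + 2 * u2) by nra.
  set (k := / sqrt (2 + 2 * u2)).
  assert (Hk : k * k * (2 + 2 * u2) = 1).
  { rewrite <- (sqrt_sqrt (2 + 2 * u2)) by lra. unfold k.
    field. apply Rgt_not_eq, sqrt_lt_R0, Hp. }
  clearbody k.
  exists (qsc k (qadd qi (0, u2, u3, u4))); split.
  + rewrite <- Hk. qcbn.
    transitivity (k * k * (1 + 2 * u2 + (0 * 0 + u2 * u2 + u3 * u3 + u4 * u4)));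
      [ring|rewrite H1; ring].
  + qcbn; qsplit; try ring.
    transitivity (- k * (u2 + (0 * 0 + u2 * u2 + u3 * u3 + u4 * u4)));
      [ring|rewrite H1; ring].
Qed.

(** * Curves in the quaternions *)

Lemma ointerval_locally a b s : ointerval a b s -> locally s (ointerval a b).
Proof.
intros [H1 H2]; apply filter_and.
- now apply (open_Rbar_gt' s a).
- now apply (open_Rbar_lt' s b).
Qed.

Lemma ointerval_convex a b s1 s2 s :
  ointerval a b s1 -> ointerval a b s2 -> s1 <= s <= s2 -> ointerval a b s.
Proof.
intros [H1 _] [_ H2] [H3 H4]; split.
- now apply Rbar_lt_le_trans with s1.
- now apply Rbar_le_lt_trans with s2.
Qed.

Lemma ointerval_inhabited a b : Rbar_lt a b -> exists s, ointerval a b s.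
Proof.
destruct a as [a| |], b as [b| |]; cbn; try contradiction; intros H.
- exists ((a + b) / 2); split; cbn; lra.
- exists (a + 1); split; cbn; trivial; lra.
- exists (b - 1); split; cbn; trivial; lra.
- exists 0; split; cbn; trivial.
Qed.

Definition is_qderive (g : R -> quat) (s : R) (v : quat) : Prop :=
  is_derive (fun u => x1 (g u)) s (x1 v) /\ is_derive (fun u => x2 (g u)) s (x2 v) /\
  is_derive (fun u => x3 (g u)) s (x3 v) /\ is_derive (fun u => x4 (g u)) s (x4 v).

Lemma is_derive_eq (f : R -> R) (x l l' : R) : is_derive f x l -> l = l' -> is_derive f x l'.
Proof. now intros H <-. Qed.

Lemma is_derive_Rmult (f g : R -> R) x f' g' : is_derive f x f' -> is_derive g x g' ->
  is_derive (fun u => f u * g u) x (f' * g x + f x * g').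
Proof. intros Hf Hg. apply (is_derive_mult f g x f' g' Hf Hg), Rmult_comm. Qed.

Lemma is_derive_Rplus (f g : R -> R) x f' g' : is_derive f x f' -> is_derive g x g' ->
  is_derive (fun u => f u + g u) x (f' + g').
Proof. exact (is_derive_plus f g x f' g'). Qed.

Lemma is_derive_Rminus (f g : R -> R) x f' g' : is_derive f x f' -> is_derive g x g' ->
  is_derive (fun u => f u - g u) x (f' - g').
Proof. exact (is_derive_minus f g x f' g'). Qed.

Lemma is_derive_Ropp (f : R -> R) x f' : is_derive f x f' ->
  is_derive (fun u => - f u) x (- f').
Proof. exact (is_derive_opp f x f'). Qed.

Lemma is_derive_Rconst (k : R) x : is_derive (fun _ : R => k) x 0.
Proof. exact (is_derive_const k x). Qed.

Ltac dstep := lazymatch goal with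
  | |- is_derive (fun u => _ + _) _ _ => eapply is_derive_Rplus
  | |- is_derive (fun u => _ - _) _ _ => eapply is_derive_Rminus
  | |- is_derive (fun u => _ * _) _ _ => eapply is_derive_Rmult
  | |- is_derive (fun u => - _) _ _ => eapply is_derive_Ropp
  | |- is_derive (fun _ => ?k) _ _ => apply (is_derive_Rconst k)
  | |- is_derive _ _ _ => eassumption
  end.
Ltac split4 := split; [|split; [|split]].
Ltac dpoly := eapply is_derive_eq; [ repeat dstep | cbv beta ].

Lemma is_qderive_unique g s v : is_qderive g s v -> qderive g s = v.
Proof.
intros (H1 & H2 & H3 & H4); apply quat_ext; now apply is_derive_unique.
Qed.

Lemma is_qderive_eq g s v w : is_qderive g s v -> v = w -> is_qderive g s w.
Proof. now intros H <-. Qed.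

Lemma is_qderive_ext_loc f g s v :
  locally s (fun u => f u = g u) -> is_qderive f s v -> is_qderive g s v.
Proof.
intros E (H1 & H2 & H3 & H4); split4;
  (eapply is_derive_ext_loc; [|eassumption]);
  (eapply filter_imp; [|exact E]); now intros u ->.
Qed.

Lemma is_qderive_mul f g s v w : is_qderive f s v -> is_qderive g s w ->
  is_qderive (fun u => qmul (f u) (g u)) s (qadd (qmul v (g s)) (qmul (f s) w)).
Proof.
intros (H1 & H2 & H3 & H4) (K1 & K2 & K3 & K4).
unfold is_qderive, qmul, qadd; cbn [x1 x2 x3 x4 fst snd].
split4; (dpoly; ring).
Qed.

Lemma is_qderive_const k s : is_qderive (fun _ => k) s (0, 0, 0, 0).
Proof. split4; apply is_derive_Rconst. Qed.

Lemma is_qderive_conj f s v : is_qderive f s v ->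
  is_qderive (fun u => qconj (f u)) s (qconj v).
Proof.
intros (H1 & H2 & H3 & H4).
unfold is_qderive, qconj; cbn [x1 x2 x3 x4 fst snd].
split4; (dpoly; ring).
Qed.

Lemma is_qderive_mull k f s v : is_qderive f s v ->
  is_qderive (fun u => qmul k (f u)) s (qmul k v).
Proof.
intros H; eapply is_qderive_eq; [apply is_qderive_mul; [apply is_qderive_const|exact H]|].
qring.
Qed.

Lemma is_qderive_mulr k f s v : is_qderive f s v ->
  is_qderive (fun u => qmul (f u) k) s (qmul v k).
Proof.
intros H; eapply is_qderive_eq; [apply is_qderive_mul; [exact H|apply is_qderive_const]|].
qring.
Qed.

Lemma is_derive_qdot f g s v w : is_qderive f s v -> is_qderive g s w ->
  is_derive (fun u => qdot (f u) (g u)) s (qdot v (g s) + qdot (f s) w).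
Proof.
intros (H1 & H2 & H3 & H4) (K1 & K2 & K3 & K4).
unfold qdot. dpoly; ring.
Qed.

Lemma derive_const_on a b (f : R -> R) s k l :
  ointerval a b s -> (forall u, ointerval a b u -> f u = k) -> is_derive f s l -> l = 0.
Proof.
intros Hs Hf Hl.
rewrite <- (is_derive_unique _ _ _ Hl).
rewrite (Derive_ext_loc f (fun _ => k)).
- apply Derive_const.
- eapply filter_imp; [|exact (ointerval_locally _ _ _ Hs)]. exact Hf.
Qed.

Lemma const_on_of_derive a b (f : R -> R) :
  (forall s, ointerval a b s -> is_derive f s 0) ->
  forall s1 s2, ointerval a b s1 -> ointerval a b s2 -> f s1 = f s2.
Proof.
intros H.
assert (W : forall s1 s2, ointerval a b s1 -> ointerval a b s2 -> s1 < s2 -> f s1 = f s2).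
{ intros s1 s2 H1 H2 L. apply eq_is_derive; [|exact L].
  intros t Ht. apply H. now apply ointerval_convex with s1 s2. }
intros s1 s2 H1 H2. destruct (Rtotal_order s1 s2) as [L|[->|L]]; auto.
symmetry; auto.
Qed.

Lemma qconst_on_of_derive a b (f : R -> quat) :
  (forall s, ointerval a b s -> is_qderive f s (0, 0, 0, 0)) ->
  forall s1 s2, ointerval a b s1 -> ointerval a b s2 -> f s1 = f s2.
Proof.
intros H s1 s2 H1 H2; apply quat_ext.
- apply (const_on_of_derive a b (fun u => x1 (f u))); trivial; apply H.
- apply (const_on_of_derive a b (fun u => x2 (f u))); trivial; apply H.
- apply (const_on_of_derive a b (fun u => x3 (f u))); trivial; apply H.
- apply (const_on_of_derive a b (fun u => x4 (f u))); trivial; apply H.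
Qed.

(** The first two derivatives are carried as data, so that conjugates and translates of a curve come
    with explicit derivatives. *)
Definition unit_speed (I : R -> Prop) (g g1 g2 : R -> quat) : Prop :=
  forall s, I s -> is_qderive g s (g1 s) /\ is_qderive g1 s (g2 s) /\
    qdot (g s) (g s) = 1 /\ qdot (g1 s) (g1 s) = 1.

Lemma arc_length_unit_speed I g : arc_length_curve I g ->
  unit_speed I g (qderive g) (qderive (qderive g)).
Proof.
intros [Hsm Hg] s Hs.
destruct (Hsm 1%nat s Hs) as (A1 & A2 & A3 & A4).
destruct (Hsm 2%nat s Hs) as (B1 & B2 & B3 & B4).
destruct (Hg s Hs) as [U V].
split4.
- split4; now apply Derive_correct.
- split4; now apply Derive_correct.
- now apply qnorm_1.
- now apply qnorm_1.
Qed.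

Section UnitSpeed.
Variables (a b : Rbar) (g g1 g2 : R -> quat).
Hypothesis Hg : unit_speed (ointerval a b) g g1 g2.

Lemma unit_speed_orth s : ointerval a b s -> qdot (g s) (g1 s) = 0.
Proof.
intros Hs. destruct (Hg s Hs) as (D1 & D2 & U & V).
assert (2 * qdot (g s) (g1 s) = 0); [|lra].
eapply (derive_const_on a b (fun u => qdot (g u) (g u)) s 1); trivial.
- intros u Hu; apply Hg, Hu.
- eapply is_derive_eq; [apply is_derive_qdot; eassumption|]. rewrite (qdot_comm (g1 s)). ring.
Qed.

Lemma unit_speed_acc s : ointerval a b s -> qdot (g s) (g2 s) = -1.
Proof.
intros Hs. destruct (Hg s Hs) as (D1 & D2 & U & V).
assert (1 + qdot (g s) (g2 s) = 0); [|lra].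
eapply (derive_const_on a b (fun u => qdot (g u) (g1 u)) s 0); trivial.
- intros u Hu; now apply unit_speed_orth.
- eapply is_derive_eq; [apply is_derive_qdot; eassumption|]. rewrite V; ring.
Qed.

Lemma unit_speed_conj : unit_speed (ointerval a b) (fun s => qconj (g s))
  (fun s => qconj (g1 s)) (fun s => qconj (g2 s)).
Proof.
intros s Hs. destruct (Hg s Hs) as (D1 & D2 & U & V).
rewrite !qdot_conj. split4; trivial; now apply is_qderive_conj.
Qed.

Lemma unit_speed_mull p : qdot p p = 1 -> unit_speed (ointerval a b) (fun s => qmul p (g s))
  (fun s => qmul p (g1 s)) (fun s => qmul p (g2 s)).
Proof.
intros Hp s Hs. destruct (Hg s Hs) as (D1 & D2 & U & V).
rewrite !qdot_mull, Hp, U, V, Rmult_1_r.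
split4; trivial; now apply is_qderive_mull.
Qed.

Lemma unit_speed_mulr p : qdot p p = 1 -> unit_speed (ointerval a b) (fun s => qmul (g s) p)
  (fun s => qmul (g1 s) p) (fun s => qmul (g2 s) p).
Proof.
intros Hp s Hs. destruct (Hg s Hs) as (D1 & D2 & U & V).
rewrite !qdot_mulr, Hp, U, V, Rmult_1_r.
split4; trivial; now apply is_qderive_mulr.
Qed.
End UnitSpeed.

Lemma x1_mul_conjl p q : x1 (qmul (qconj p) q) = qdot p q.
Proof. qring. Qed.

Lemma x1_mul_conjr p q : x1 (qmul p (qconj q)) = qdot p q.
Proof. qring. Qed.

(** On imaginary quaternions [vprod qone] is the cross product, and this is Lagrange's identity. *)
Lemma vprod_one_norm u v : x1 u = 0 -> x1 v = 0 ->
  qdot (vprod qone u v) (vprod qone u v) = qdot u u * qdot v v - qdot u v ^ 2.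
Proof.
destruct u as [[[u1 u2] u3] u4], v as [[[v1 v2] v3] v4].
qcbn; intros -> ->; ring.
Qed.

(** * Mean curvature of a translation surface *)

(** For unit [p] and [q] this is a rotation of R^4. With [p = f s] and [q = g t] it carries [qone],
    [T] and [qconj S] to the point of the surface and its two coordinate tangent vectors. *)
Definition sandwich (p q u : quat) : quat := qmul (qmul p u) q.

Lemma qdot_sandwich p q u v : qdot p p = 1 -> qdot q q = 1 ->
  qdot (sandwich p q u) (sandwich p q v) = qdot u v.
Proof. intros Hp Hq; unfold sandwich; rewrite qdot_mulr, qdot_mull, Hp, Hq; ring. Qed.

Lemma vprod_sandwich p q u v w : qdot p p = 1 -> qdot q q = 1 ->
  vprod (sandwich p q u) (sandwich p q v) (sandwich p q w) = sandwich p q (vprod u v w).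
Proof.
intros Hp Hq; unfold sandwich; rewrite vprod_mulr, vprod_mull, Hp, Hq, !qsc_1; trivial.
Qed.

Lemma qsc_sandwich k p q u : qsc k (sandwich p q u) = sandwich p q (qsc k u).
Proof. unfold sandwich; qring. Qed.

Lemma qadd_sandwich p q u v :
  qadd (sandwich p q u) (sandwich p q v) = sandwich p q (qadd u v).
Proof. unfold sandwich; qring. Qed.

Lemma qsub_sandwich p q u v :
  qsub (sandwich p q u) (sandwich p q v) = sandwich p q (qsub u v).
Proof. unfold sandwich; qring. Qed.

Lemma tan_proj_sandwich p q u v : qdot p p = 1 -> qdot q q = 1 ->
  tan_proj (sandwich p q u) (sandwich p q v) = sandwich p q (tan_proj u v).
Proof.
intros Hp Hq; unfold tan_proj.
now rewrite qdot_sandwich, !scal_qsc, !minus_qsub, qsc_sandwich, qsub_sandwich.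
Qed.

(** The product of imaginary quaternions is [T S = - <T, S> + T x S], and [qconj S = - S]. *)
Lemma vprod_one_qdot C T S : x1 T = 0 -> x1 S = 0 ->
  qdot C (vprod qone T (qconj S)) = - qdot C (qmul T S) - x1 C * qdot T S.
Proof.
destruct C as [[[C1 C2] C3] C4], T as [[[T1 T2] T3] T4], S as [[[S1 S2] S3] S4].
qcbn; intros -> ->; ring.
Qed.

Lemma qdot_tan_proj_one C T S k :
  qdot (tan_proj qone C) (qsc k (vprod qone T S)) = k * qdot C (vprod qone T S).
Proof. unfold tan_proj; rewrite scal_qsc, minus_qsub; qring. Qed.

Lemma qdot_qsub_l u v w : qdot (qsub u v) w = qdot u w - qdot v w.
Proof. qring. Qed.

Lemma qdot_conj_imag u v : x1 v = 0 -> qdot u (qconj v) = - qdot u v.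
Proof. unfold qdot, qconj; cbn [x1 x2 x3 x4 fst snd]; intros ->; ring. Qed.

Lemma qdot_qsub_qsc u v k : qdot (qsub u (qsc k v)) (qsub u (qsc k v)) =
  qdot u u - 2 * k * qdot u v + k ^ 2 * qdot v v.
Proof. qring. Qed.

Lemma qadd_opp_qsc u v k : qadd (qsc 1 u) (qsc k (qsc (-1) v)) = qsub u (qsc k v).
Proof. qring. Qed.

Lemma sandwich_0 p q : sandwich p q (0, 0, 0, 0) = (0, 0, 0, 0).
Proof. unfold sandwich; qring. Qed.

Lemma qdot_conj_l u v : qdot (qconj u) v = 2 * x1 u * x1 v - qdot u v.
Proof. qring. Qed.

Lemma x1_qmul_imag u v : x1 u = 0 -> x1 (qmul u v) = - qdot u v.
Proof. unfold qdot, qmul; cbn [x1 x2 x3 x4 fst snd]; intros ->; ring. Qed.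

Lemma qconj_imag u : x1 u = 0 -> qconj u = qsc (-1) u.
Proof. destruct u as [[[u1 u2] u3] u4]; cbn; intros ->; qring. Qed.

(* [T] and [S] are [Tleft] and [Tright]; the derivatives of these are
   [1 + conj f * f2] and [1 + g * conj g2].  With [h] the opposite of the mean
   curvature this is [<T' - S', T x S> - 2 w r^2 = 2 h r^3], where
   [r = |T x S|]. *)
Definition translation_cmc (I J : R -> Prop) (f f1 f2 g g1 g2 : R -> quat) (h : R) : Prop :=
  forall s t, I s -> J t ->
  let T := qmul (qconj (f s)) (f1 s) in
  let S := qmul (g t) (qconj (g1 t)) in
  let w := qdot T S in
  w ^ 2 < 1 /\
  qdot (qsub (qmul (qconj (f s)) (f2 s)) (qmul (g t) (qconj (g2 t)))) (qmul T S)
    - 2 * w * (1 - w ^ 2) = 2 * h * (1 - w ^ 2) * sqrt (1 - w ^ 2).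

Lemma qmul_unit_cancell p u : qdot p p = 1 -> qmul p (qmul (qconj p) u) = u.
Proof. intros H; rewrite qmul_assoc, unit_mulr, qmul_1l; trivial. Qed.

Lemma qmul_unit_cancell' p u : qdot p p = 1 -> qmul (qconj p) (qmul p u) = u.
Proof. intros H; rewrite qmul_assoc, unit_mull, qmul_1l; trivial. Qed.

Lemma qmul_unit_cancelr p u : qdot p p = 1 -> qmul (qmul u (qconj p)) p = u.
Proof. intros H; rewrite <- qmul_assoc, unit_mull, qmul_1r; trivial. Qed.

Lemma qmul_unit_cancelr' p u : qdot p p = 1 -> qmul (qmul u p) (qconj p) = u.
Proof. intros H; rewrite <- qmul_assoc, unit_mulr, qmul_1r; trivial. Qed.

Section MeanCurvature.
Variables (a b c d : Rbar) (f f1 f2 g g1 g2 : R -> quat).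
Hypothesis Hf : unit_speed (ointerval a b) f f1 f2.
Hypothesis Hg : unit_speed (ointerval c d) g g1 g2.
Variables s t : R.
Hypotheses (Hs : ointerval a b s) (Ht : ointerval c d t).

Let X := translation f g.
Let T := qmul (qconj (f s)) (f1 s).
Let S := qmul (g t) (qconj (g1 t)).
Let A := qmul (qconj (f s)) (f2 s).
Let B := qmul (g t) (qconj (g2 t)).
Let w := qdot T S.

Lemma translation_d_s u v : ointerval a b u -> d_s X u v = qmul (f1 u) (g v).
Proof. intros Hu; apply is_qderive_unique, is_qderive_mulr, Hf, Hu. Qed.

Lemma translation_d_t u v : ointerval c d v -> d_t X u v = qmul (f u) (g1 v).
Proof. intros Hv; apply is_qderive_unique, is_qderive_mull, Hg, Hv. Qed.

Lemma translation_d_ss : d_s (d_s X) s t = qmul (f2 s) (g t).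
Proof.
apply is_qderive_unique; eapply is_qderive_ext_loc; [|apply is_qderive_mulr, Hf, Hs].
eapply filter_imp; [|exact (ointerval_locally _ _ _ Hs)].
intros u Hu; symmetry; now apply translation_d_s.
Qed.

Lemma translation_d_ts : d_t (d_s X) s t = qmul (f1 s) (g1 t).
Proof.
apply is_qderive_unique; eapply is_qderive_ext_loc; [|apply is_qderive_mull, Hg, Ht].
apply filter_forall; intros u; symmetry; now apply translation_d_s.
Qed.

Lemma translation_d_tt : d_t (d_t X) s t = qmul (f s) (g2 t).
Proof.
apply is_qderive_unique; eapply is_qderive_ext_loc; [|apply is_qderive_mull, Hg, Ht].
eapply filter_imp; [|exact (ointerval_locally _ _ _ Ht)].
intros u Hu; symmetry; now apply translation_d_t.
Qed.

Lemma Tleft_imaginary : x1 T = 0.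
Proof. unfold T; rewrite x1_mul_conjl; eapply unit_speed_orth; eassumption. Qed.

Lemma Tright_imaginary : x1 S = 0.
Proof. unfold S; rewrite x1_mul_conjr; eapply unit_speed_orth; eassumption. Qed.

Lemma Tleft_unit : qdot T T = 1.
Proof.
destruct (Hf s Hs) as (_ & _ & U & V). unfold T.
rewrite qdot_mull, qdot_conj, U, V; ring.
Qed.

Lemma Tright_unit : qdot S S = 1.
Proof.
destruct (Hg t Ht) as (_ & _ & U & V). unfold S.
rewrite qdot_mull, qdot_conj, U, V; ring.
Qed.

Let L := sandwich (f s) (g t).

Lemma f1_g : qmul (f1 s) (g t) = L T.
Proof.
destruct (Hf s Hs) as (_ & _ & U & V).
unfold L, sandwich, T; now rewrite qmul_unit_cancell.
Qed.

Lemma f2_g : qmul (f2 s) (g t) = L A.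
Proof.
destruct (Hf s Hs) as (_ & _ & U & V).
unfold L, sandwich, A; now rewrite qmul_unit_cancell.
Qed.

Lemma f_g1 : qmul (f s) (g1 t) = L (qconj S).
Proof.
destruct (Hg t Ht) as (_ & _ & U & V).
unfold L, sandwich, S; now rewrite qconj_mul, qconj_conj, <- qmul_assoc, qmul_unit_cancelr.
Qed.

Lemma f_g2 : qmul (f s) (g2 t) = L (qconj B).
Proof.
destruct (Hg t Ht) as (_ & _ & U & V).
unfold L, sandwich, B; now rewrite qconj_mul, qconj_conj, <- qmul_assoc, qmul_unit_cancelr.
Qed.

Lemma f1_g1 : qmul (f1 s) (g1 t) = L (qmul T (qconj S)).
Proof.
destruct (Hg t Ht) as (_ & _ & U & V).
destruct (Hf s Hs) as (_ & _ & U' & V').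
unfold L, sandwich, S, T.
now rewrite qconj_mul, qconj_conj, qmul_assoc, qmul_unit_cancell, <- qmul_assoc,
  qmul_unit_cancelr.
Qed.

(** The tangent vectors are the images of [T] and [- S] under the rotation [L], and
    [|T - w S|^2 = 1 - w^2]. *)
Lemma translation_regular :
  regular_on (ointerval a b) (ointerval c d) X -> w ^ 2 < 1.
Proof.
intros R.
destruct (Rlt_or_le (w ^ 2) 1) as [H|H]; trivial; exfalso.
assert (E : qdot (qsub T (qsc w S)) (qsub T (qsc w S)) = 1 - w ^ 2).
{ rewrite qdot_qsub_qsc, Tleft_unit, Tright_unit; fold w; ring. }
assert (Z : qsub T (qsc w S) = (0, 0, 0, 0)).
{ apply qdot_0. rewrite E. apply Rle_antisym; [lra|].
  rewrite <- E. unfold qdot; nra. }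
assert (1 = 0); [|lra].
(* The combination [X_s + w X_t] is [L (T - w S)], which is zero by [Z]. *)
apply (R s t Hs Ht 1 w).
rewrite translation_d_s, translation_d_t, f1_g, f_g1 by assumption.
rewrite plus_qadd, !scal_qsc. unfold L.
rewrite (qconj_imag _ Tright_imaginary), !qsc_sandwich, qadd_sandwich.
rewrite qadd_opp_qsc, Z. apply sandwich_0.
Qed.

(** Here [E = G = 1], [F = - w], and the unit normal is the image under [L] of [- (T x S) / r] with
    [r^2 = 1 - w^2]. The mixed coefficient is [m = r], so [- 2 m F] is the origin of the term
    [2 w (1 - w^2)]; the coefficients [l] and [n] give the products with [A] and [B]. *)
Lemma mean_curvature_translation : w ^ 2 < 1 ->
  qdot (qsub A B) (qmul T S) - 2 * w * (1 - w ^ 2) =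
  2 * - mean_curvature X s t * (1 - w ^ 2) * sqrt (1 - w ^ 2).
Proof.
intros Hw.
destruct (Hf s Hs) as (_ & _ & U & _). destruct (Hg t Ht) as (_ & _ & V & _).
unfold mean_curvature, unit_normal.
rewrite translation_d_ss, translation_d_ts, translation_d_tt.
rewrite translation_d_s, translation_d_t by assumption.
rewrite f1_g, f2_g, f_g1, f_g2, f1_g1.
replace (X s t) with (L qone) by (unfold L, sandwich; now rewrite qmul_1r).
unfold L. rewrite !vprod_sandwich, !tan_proj_sandwich, !scal_qsc, !qsc_sandwich by assumption.
unfold qnorm. rewrite !qdot_sandwich by assumption. rewrite qdot_conj.
assert (HT := Tleft_unit). assert (HS := Tright_unit).
assert (IT := Tleft_imaginary). assert (IS := Tright_imaginary).
assert (IA : x1 A = -1).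
{ unfold A; rewrite x1_mul_conjl; eapply unit_speed_acc; eassumption. }
assert (IB : x1 B = -1).
{ unfold B; rewrite x1_mul_conjr; eapply unit_speed_acc; eassumption. }
rewrite vprod_one_norm by exact Tleft_imaginary || exact Tright_imaginary.
rewrite qdot_conj, HT, HS.
assert (W : qdot T (qconj S) = - w).
{ unfold w. unfold qdot, qconj; cbn [x1 x2 x3 x4 fst snd]. rewrite IT; ring. }
rewrite W.
replace (1 * 1 - (- w) ^ 2) with (1 - w ^ 2) by ring.
set (r := sqrt (1 - w ^ 2)).
assert (Hr : 0 < r) by (apply sqrt_lt_R0; lra).
assert (Hr2 : 1 - w ^ 2 = r * r) by (unfold r; rewrite sqrt_sqrt; lra).
clearbody r.
rewrite !qdot_tan_proj_one, !vprod_one_qdot, qdot_qsub_l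
  by (apply Tleft_imaginary || apply Tright_imaginary).
rewrite IA. replace (x1 (qconj B)) with (-1) by (now symmetry).
fold w.
assert (K2 : qdot (qconj B) (qmul T S) = 2 * w - qdot B (qmul T S)).
{ rewrite qdot_conj_l, x1_qmul_imag, IB by trivial. fold w; ring. }
rewrite x1_mul_conjr, qdot_mull, (qdot_comm (qconj S)), qdot_conj_imag, HT, HS, K2 by trivial.
fold w.
replace (1 * 1 - (- w) ^ 2) with (1 - w ^ 2) by ring.
rewrite Hr2. replace (w * w) with (1 - r * r) by (rewrite <- Hr2; ring).
field. lra.
Qed.
End MeanCurvature.

(** * The Hopf fibration and tori *)

(** For [l > 0] the difference quotients give [f (t0 - k) < f t0 < f (t0 + k)] for a small [k], and
    the intermediate value theorem fills the gap. The case [l < 0] follows by passing to [- f]. *)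
Lemma local_surjectivity a b (f : R -> R) t0 l d :
  (forall t, ointerval a b t -> exists l, is_derive f t l) -> ointerval a b t0 ->
  is_derive f t0 l -> l <> 0 -> 0 < d ->
  exists e, 0 < e /\ forall v, Rabs (v - f t0) < e ->
    exists t, ointerval a b t /\ Rabs (t - t0) < d /\ f t = v.
Proof.
intros Hf Ht0.
assert (W : forall (f : R -> R) l, (forall t, ointerval a b t -> exists l, is_derive f t l) ->
  is_derive f t0 l -> 0 < l -> 0 < d ->
  exists e, 0 < e /\ forall v, Rabs (v - f t0) < e ->
    exists t, ointerval a b t /\ Rabs (t - t0) < d /\ f t = v).
{ clear f l Hf. intros f l Hf Hl L D.
  (* The tolerance [l] itself keeps the difference quotients positive. *)
  apply is_derive_Reals in Hl. destruct (Hl l L) as [d1 Hd1].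
  destruct (ointerval_locally _ _ _ Ht0) as [d2 Hd2].
  set (k := Rmin (Rmin d d1) d2 / 2).
  assert (Hk : 0 < k /\ k < d /\ k < d1 /\ k < d2).
  { assert (H1 := cond_pos d1). assert (H2 := cond_pos d2).
    assert (0 < Rmin (Rmin d d1) d2) by now repeat apply Rmin_glb_lt.
    assert (H3 := Rmin_l (Rmin d d1) d2). assert (H4 := Rmin_r (Rmin d d1) d2).
    assert (H5 := Rmin_l d d1). assert (H6 := Rmin_r d d1).
    unfold k; repeat split; lra. }
  destruct Hk as (K0 & K1 & K2 & K3). clearbody k.
  assert (I1 : forall t, t0 - k <= t <= t0 + k -> ointerval a b t).
  { intros t Ht. apply Hd2. change (Rabs (t - t0) < d2). apply Rabs_def1; lra. }
  assert (A1 : f (t0 - k) < f t0).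
  { assert (Q := Hd1 (- k) ltac:(lra) ltac:(rewrite Rabs_left; lra)).
    apply Rabs_def2 in Q. destruct Q as [_ Q].
    assert (0 < (f (t0 + - k) - f t0) / - k) by lra.
    assert ((f (t0 + - k) - f t0) = - (k * ((f (t0 + - k) - f t0) / - k))) by (field; lra).
    unfold Rminus. nra. }
  assert (A2 : f t0 < f (t0 + k)).
  { assert (Q := Hd1 k ltac:(lra) ltac:(rewrite Rabs_right; lra)).
    apply Rabs_def2 in Q. destruct Q as [_ Q].
    assert (0 < (f (t0 + k) - f t0) / k) by lra.
    assert ((f (t0 + k) - f t0) = (k * ((f (t0 + k) - f t0) / k))) by (field; lra).
    nra. }
  exists (Rmin (f t0 - f (t0 - k)) (f (t0 + k) - f t0)); split.
  - apply Rmin_glb_lt; lra.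
  - intros v Hv.
    assert (H3 := Rmin_l (f t0 - f (t0 - k)) (f (t0 + k) - f t0)).
    assert (H4 := Rmin_r (f t0 - f (t0 - k)) (f (t0 + k) - f t0)).
    apply Rabs_def2 in Hv.
    destruct (Ranalysis5.IVT_interv (fun t => f t - v) (t0 - k) (t0 + k)) as (t & Ht & E).
    + intros t Ht. destruct (Hf t (I1 t Ht)) as [m Hm].
      apply continuity_pt_minus; [|apply continuity_pt_const; now intros ? ?].
      apply derivable_continuous_pt. exists m. now apply is_derive_Reals.
    + lra.
    + lra.
    + lra.
    + exists t; split; [now apply I1|split; [apply Rabs_def1; lra|lra]]. }
intros Hl L D. destruct (Rtotal_order l 0) as [N|[N|N]]; [|contradiction|eauto].
destruct (W (fun t => - f t) (- l)) as (e & E & P); trivial.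
- intros t Ht; destruct (Hf t Ht) as [m Hm]; exists (- m); now apply is_derive_Ropp.
- now apply is_derive_Ropp.
- lra.
- exists e; split; trivial. intros v Hv.
  destruct (P (- v)) as (t & T1 & T2 & T3).
  + replace (- v - - f t0) with (- (v - f t0)) by ring. now rewrite Rabs_Ropp.
  + exists t; repeat split; trivial; try apply T1. lra.
Qed.

(** The balls of the product uniform structure on [quat] are cubes. *)
Definition near (e : R) (p q : quat) : Prop :=
  Rabs (x1 q - x1 p) < e /\ Rabs (x2 q - x2 p) < e /\
  Rabs (x3 q - x3 p) < e /\ Rabs (x4 q - x4 p) < e.

Lemma near_locally (p : quat) (P : quat -> Prop) :
  locally p P <-> exists e, 0 < e /\ forall q, near e p q -> P q.
Proof.
split.
- intros [e He]; exists e; split; [apply cond_pos|].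
  intros q (H1 & H2 & H3 & H4). apply He. now repeat split.
- intros (e & E & He). exists (mkposreal e E). intros q [[[H1 H2] H3] H4].
  apply He. now repeat split.
Qed.

Lemma is_qderive_near g s v e : is_qderive g s v -> 0 < e ->
  exists d, 0 < d /\ forall u, Rabs (u - s) < d -> near e (g s) (g u).
Proof.
intros (H1 & H2 & H3 & H4) E.
assert (W : forall f : R -> R, forall l, is_derive f s l ->
  locally s (fun u => Rabs (f u - f s) < e)).
{ intros f l Hl.
  assert (K : continuous f s).
  { apply (ex_derive_continuous (V := R_NormedModule)); now exists l. }
  apply (K (fun y => Rabs (y - f s) < e)). now exists (mkposreal e E). }
assert (Q := filter_and _ _ (W _ _ H1) (filter_and _ _ (W _ _ H2)
  (filter_and _ _ (W _ _ H3) (W _ _ H4)))).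
destruct Q as [d Hd]. exists d; split; [apply cond_pos|]. exact Hd.
Qed.

Lemma near_trans d e p q r : near d p q -> near e p r -> near (d + e) q r.
Proof.
intros (H1 & H2 & H3 & H4) (K1 & K2 & K3 & K4).
unfold near; split4;
  repeat match goal with H : Rabs _ < _ |- _ => apply Rabs_def2 in H end;
  apply Rabs_def1; lra.
Qed.

Definition hopf (y : quat) : quat := qmul (qmul (qconj y) qi) y.

Lemma hopf_x1 y : x1 (hopf y) = 0.
Proof. unfold hopf; qring. Qed.

Lemma hopf_x2 y : x2 (hopf y) = x1 y * x1 y + x2 y * x2 y - x3 y * x3 y - x4 y * x4 y.
Proof. unfold hopf; qring. Qed.

Lemma hopf_x3 y : x3 (hopf y) = 2 * (x2 y * x3 y + - x1 y * x4 y).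
Proof. unfold hopf; qring. Qed.

Lemma hopf_x4 y : x4 (hopf y) = 2 * (x2 y * x4 y + x1 y * x3 y).
Proof. unfold hopf; qring. Qed.

Lemma qdot_hopf y : qdot (hopf y) (hopf y) = qdot y y * qdot y y.
Proof. unfold hopf; qring. Qed.

Lemma unit_coord y : qdot y y = 1 ->
  Rabs (x1 y) <= 1 /\ Rabs (x2 y) <= 1 /\ Rabs (x3 y) <= 1 /\ Rabs (x4 y) <= 1.
Proof. unfold qdot; intros H; split4; apply Rabs_le; nra. Qed.

Lemma prod_close a b a' b' e : Rabs a <= 1 -> Rabs b' <= 1 ->
  Rabs (a' - a) < e -> Rabs (b' - b) < e -> Rabs (a' * b' - a * b) <= 2 * e.
Proof.
intros A B C D.
replace (a' * b' - a * b) with ((a' - a) * b' + a * (b' - b)) by ring.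
eapply Rle_trans; [apply Rabs_triang|]. rewrite !Rabs_mult.
assert (X := Rabs_pos a). assert (Y := Rabs_pos b').
assert (X' := Rabs_pos (a' - a)). assert (Y' := Rabs_pos (b' - b)).
nra.
Qed.

(** Each coordinate is twice a sum of two products, and each product moves by at most [2 * e]. *)
Lemma hopf_near e y z : qdot y y = 1 -> qdot z z = 1 -> near e y z ->
  Rabs (x3 (hopf z) - x3 (hopf y)) <= 8 * e /\ Rabs (x4 (hopf z) - x4 (hopf y)) <= 8 * e.
Proof.
intros Hy Hz (N1 & N2 & N3 & N4).
destruct (unit_coord y Hy) as (Y1 & Y2 & Y3 & Y4).
destruct (unit_coord z Hz) as (Z1 & Z2 & Z3 & Z4).
assert (B1 := prod_close _ _ _ _ e Y2 Z3 N2 N3).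
assert (B2 := prod_close _ _ _ _ e Y1 Z4 N1 N4).
assert (B3 := prod_close _ _ _ _ e Y2 Z4 N2 N4).
assert (B4 := prod_close _ _ _ _ e Y1 Z3 N1 N3).
rewrite !hopf_x3, !hopf_x4.
repeat match goal with H : Rabs (_ * _ - _) <= _ |- _ => apply Rabs_le_between in H end.
split; apply Rabs_le; lra.
Qed.

(** As [y] is a unit, these are coordinates of [(z - y) conj y], sums of four products bounded by
    [e]. *)
Lemma qmul_near_one e y z : qdot y y = 1 -> near e y z ->
  Rabs (x1 (qmul z (qconj y)) - 1) <= 4 * e /\ Rabs (x2 (qmul z (qconj y))) <= 4 * e.
Proof.
intros Hy (N1 & N2 & N3 & N4).
destruct (unit_coord y Hy) as (Y1 & Y2 & Y3 & Y4).
assert (W : forall u v, Rabs u < e -> Rabs v <= 1 -> - e <= u * v <= e).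
{ intros u v U V. apply Rabs_le_between. rewrite Rabs_mult.
  assert (X := Rabs_pos u). assert (Y := Rabs_pos v). nra. }
assert (W11 := W _ _ N1 Y1). assert (W12 := W _ _ N1 Y2).
assert (W22 := W _ _ N2 Y2). assert (W21 := W _ _ N2 Y1).
assert (W33 := W _ _ N3 Y3). assert (W34 := W _ _ N3 Y4).
assert (W44 := W _ _ N4 Y4). assert (W43 := W _ _ N4 Y3).
replace (x1 (qmul z (qconj y)) - 1) with (x1 (qmul z (qconj y)) - qdot y y) by (rewrite Hy; ring).
clear - W11 W12 W22 W21 W33 W34 W44 W43.
unfold qmul, qconj, qdot; cbn [x1 x2 x3 x4 fst snd].
split; apply Rabs_le; lra.
Qed.

(** The circle [exp (i s)], whose action by left multiplication sweeps out the Hopf fibres. *)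
Definition rot (s : R) : quat := (cos s, sin s, 0, 0).

(** Equal Hopf images make [q = z conj y] commute with [i], so that [q] is a unit complex number.
    Its positive real part allows the angle to be read off with [atan]. *)
Lemma hopf_eq_rot y z : qdot y y = 1 -> qdot z z = 1 -> hopf y = hopf z ->
  0 < x1 (qmul z (qconj y)) ->
  z = qmul (rot (atan (x2 (qmul z (qconj y)) / x1 (qmul z (qconj y))))) y.
Proof.
intros Hy Hz H P.
set (q := qmul z (qconj y)) in *.
assert (Hq : qdot q q = 1) by (unfold q; rewrite qdot_mull, qdot_conj, Hy, Hz; ring).
assert (Zq : z = qmul q y) by (unfold q; now rewrite qmul_unit_cancelr).
assert (Cq : qmul q qi = qmul qi q).
{ transitivity (qmul z (qmul (hopf y) (qconj y))).
  - unfold q, hopf. rewrite <- (qmul_assoc _ y), unit_mulr, qmul_1r by trivial.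
    symmetry; apply qmul_assoc.
  - rewrite H; unfold hopf, q. rewrite !qmul_assoc, unit_mulr, qmul_1l by trivial. reflexivity. }
rewrite Zq at 1. f_equal.
clearbody q. destruct q as [[[q1 q2] q3] q4].
assert (q3 = 0 /\ q4 = 0) as [-> ->].
{ apply (f_equal x3) in Cq as C3. apply (f_equal x4) in Cq as C4. revert C3 C4.
  qcbn. lra. }
unfold rot; cbn [x1 x2 fst snd] in *. rewrite cos_atan, sin_atan.
assert (E : sqrt (1 + Rsqr (q2 / q1)) = / q1).
{ replace (1 + Rsqr (q2 / q1)) with (Rsqr (/ q1)).
  - apply sqrt_Rsqr. now apply Rlt_le, Rinv_0_lt_compat.
  - unfold Rsqr. qcbn. replace (/ q1 * / q1) with
     ((q1 * q1 + q2 * q2 + 0 * 0 + 0 * 0) * (/ q1 * / q1)) by (rewrite Hq; ring).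
    field; lra. }
rewrite E. qsplit; try field; lra.
Qed.

Lemma atan_small d : 0 < d -> exists k, 0 < k /\ forall x, Rabs x < k -> Rabs (atan x) < d.
Proof.
intros D.
assert (K : continuous atan 0).
{ apply continuity_pt_filterlim, derivable_continuous_pt, derivable_pt_atan. }
destruct (K (fun y => Rabs (y - atan 0) < d)) as [k Hk].
{ now exists (mkposreal d D). }
exists k; split; [apply cond_pos|]. intros x Hx.
assert (H := Hk x). rewrite atan_0 in H. rewrite <- (Rminus_0_r (atan x)). apply H.
change (Rabs (x - 0) < k). now rewrite Rminus_0_r.
Qed.

Lemma is_qderive_hopf g s v : is_qderive g s v ->
  is_qderive (fun u => hopf (g u)) s
    (qadd (qmul (qmul (qconj v) qi) (g s)) (qmul (qmul (qconj (g s)) qi) v)).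
Proof.
intros H. apply is_qderive_mul; trivial.
now apply is_qderive_mulr, is_qderive_conj.
Qed.

(** Up to conjugation by [y], the velocity [h] of the Hopf image is [S i - i S], twice the cross
    product of [S] and [i]. *)
Lemma hopf_speed y v : qdot y y = 1 -> qdot y v = 0 ->
  let S := qmul y (qconj v) in
  let h := qadd (qmul (qmul (qconj v) qi) y) (qmul (qmul (qconj y) qi) v) in
  qdot h h = 4 * (x3 S * x3 S + x4 S * x4 S).
Proof.
intros Hy Hv S h.
assert (IS : x1 S = 0) by (unfold S; now rewrite x1_mul_conjr).
assert (E1 : qconj v = qmul (qconj y) S) by (unfold S; now rewrite qmul_unit_cancell').
assert (E2 : v = qmul (qconj S) y).
{ rewrite <- (qconj_conj v), E1, qconj_mul, qconj_conj; trivial. }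
assert (E : h = sandwich (qconj y) y (qadd (qmul S qi) (qmul qi (qconj S)))).
{ unfold h. rewrite E1. rewrite E2 at 1. generalize S y; clear. unfold sandwich. qring. }
rewrite E, qdot_sandwich by (rewrite ?qdot_conj; trivial).
destruct S as [[[S1 S2] S3] S4]; cbn in IS; subst. qcbn; ring.
Qed.

(** The preimage of the circle of latitude at height [c]. By [hopf_x2] the height is the difference
    of the two squared radii, whose sum is 1, so they are [(1 + c) / 2] and [(1 - c) / 2]. *)
Definition on_torus (c : R) (y : quat) : Prop := qdot y y = 1 /\ x2 (hopf y) = c.

Lemma on_torus_hopf c y : on_torus c y ->
  x3 (hopf y) * x3 (hopf y) + x4 (hopf y) * x4 (hopf y) = 1 - c * c.
Proof.
intros [H1 H2]. assert (H := qdot_hopf y). rewrite H1 in H. unfold qdot in H.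
rewrite H2, hopf_x1 in H. lra.
Qed.

(** By Lagrange's identity, the length of a plane vector and its determinant against [(p', q')] fix
    the square of its inner product with [(p', q')]; positivity fixes the sign. Inner product and
    determinant together determine the vector. *)
Lemma planar_eq p q u v p' q' : p * p + q * q = u * u + v * v ->
  p * q' - q * p' = u * q' - v * p' -> 0 < p * p' + q * q' -> 0 < u * p' + v * q' ->
  p = u /\ q = v.
Proof.
intros H1 H2 H3 H4.
assert (N : 0 < p' * p' + q' * q').
{ destruct (Req_dec p' 0) as [->|]; [destruct (Req_dec q' 0) as [->|]; nra|nra]. }
assert (D : p * p' + q * q' = u * p' + v * q').
{ apply Rsqr_inj; try lra. unfold Rsqr.
  assert ((p * p + q * q) * (p' * p' + q' * q') = (u * u + v * v) * (p' * p' + q' * q'))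
    by now rewrite H1.
  assert ((p * q' - q * p') * (p * q' - q * p') = (u * q' - v * p') * (u * q' - v * p'))
    by now rewrite H2.
  lra. }
split; apply (Rmult_eq_reg_r (p' * p' + q' * q')); try lra.
- transitivity ((p * p' + q * q') * p' + (p * q' - q * p') * q'); [ring|].
  rewrite D, H2; ring.
- transitivity ((p * p' + q * q') * q' - (p * q' - q * p') * p'); [ring|].
  rewrite D, H2; ring.
Qed.

Section LocalTorus.
Variables (a b : Rbar) (g g1 g2 : R -> quat) (c : R).
Hypothesis Hg : unit_speed (ointerval a b) g g1 g2.
Hypothesis Hc : c * c < 1.
Hypothesis Htorus : forall t, ointerval a b t -> on_torus c (g t).
Hypothesis Hspeed : forall t, ointerval a b t ->
  let S := qmul (g t) (qconj (g1 t)) in 0 < x3 S * x3 S + x4 S * x4 S.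

(** A point [y] is reached in two moves. Sliding along [g] matches its Hopf image, by
    [local_surjectivity] on the circle in the base; then [y] and [g t] are close points of one fibre
    and differ by a small rotation. *)
Lemma torus_local_param t0 d : ointerval a b t0 -> 0 < d ->
  exists e, 0 < e /\ forall y, on_torus c y -> near e (g t0) y ->
    exists t s, ointerval a b t /\ Rabs s < d /\ y = qmul (rot s) (g t).
Proof.
intros Ht0 D.
destruct (Hg t0 Ht0) as (D1 & _ & U0 & _).
destruct (atan_small d D) as (k & K & Hk).
set (p := x3 (hopf (g t0))). set (q := x4 (hopf (g t0))).
assert (Hpq : p * p + q * q = 1 - c * c) by apply on_torus_hopf, Htorus, Ht0.
assert (Bp : -1 <= p <= 1) by nra. assert (Bq : -1 <= q <= 1) by nra.
(* Up to a positive factor, [F z] is the sine of the angle between the positions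
   of [z] and [g t0] on the circle in the base of the Hopf fibration. *)
set (F := fun z : quat => x3 (hopf z) * q - x4 (hopf z) * p).
assert (HF : forall e z, qdot z z = 1 -> near e (g t0) z ->
  Rabs (F z) <= 16 * e /\ 1 - c * c - 16 * e <= x3 (hopf z) * p + x4 (hopf z) * q).
{ intros e z Uz N. destruct (hopf_near e _ _ U0 Uz N) as [N3 N4].
  fold p in N3. fold q in N4. rewrite <- Hpq. unfold F.
  revert N3 N4. generalize (x3 (hopf z)) (x4 (hopf z)); intros P Q N3 N4.
  replace (P * q - Q * p) with ((P - p) * q + - ((Q - q) * p)) by ring.
  replace (P * p + Q * q) with (p * p + q * q + ((P - p) * p + (Q - q) * q)) by ring.
  assert (W : forall u v, Rabs u <= 8 * e -> -1 <= v <= 1 -> - (8 * e) <= u * v <= 8 * e).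
  { intros u v Hu Hv. apply Rabs_le_between. rewrite Rabs_mult.
    assert (Rabs v <= 1) by (apply Rabs_le; lra).
    assert (X := Rabs_pos u). assert (Y := Rabs_pos v). nra. }
  assert (W1 := W _ _ N3 Bq). assert (W2 := W _ _ N4 Bp).
  assert (W3 := W _ _ N3 Bp). assert (W4 := W _ _ N4 Bq).
  split; [apply Rabs_le|]; lra. }
(* The first bound keeps the inner products with [(p, q)] at least [(1 - c * c) / 2], as [planar_eq]
   requires. The second keeps the real part of [y conj (g t)] at least [1 / 2]: the two points are
   within [2 * e0], which [qmul_near_one] turns into [8 * e0]. With the third, the argument of
   [atan] is at most [k / 2]. *)
set (e0 := Rmin ((1 - c * c) / 32) (Rmin (1 / 16) (k / 32))).
assert (E0 : 0 < e0 /\ e0 <= (1 - c * c) / 32 /\ e0 <= 1 / 16 /\ e0 <= k / 32).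
{ assert (A1 := Rmin_l ((1 - c * c) / 32) (Rmin (1 / 16) (k / 32))).
  assert (A2 := Rmin_r ((1 - c * c) / 32) (Rmin (1 / 16) (k / 32))).
  assert (A3 := Rmin_l (1 / 16) (k / 32)). assert (A4 := Rmin_r (1 / 16) (k / 32)).
  fold e0 in A1, A2. repeat split; try lra.
  unfold e0. repeat apply Rmin_glb_lt; lra. }
destruct E0 as (E0 & E1 & E2 & E3). clearbody e0.
destruct (is_qderive_near _ _ _ e0 D1 E0) as (d1 & Hd1 & Nd1).
assert (Fd : forall t, ointerval a b t -> exists l, is_derive (fun u => F (g u)) t l).
{ intros t Ht. destruct (Hg t Ht) as (Dt & _).
  destruct (is_qderive_hopf _ _ _ Dt) as (_ & _ & H3 & H4).
  eexists; unfold F; dpoly. reflexivity. }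
destruct (is_qderive_hopf _ _ _ D1) as (_ & H2 & H3 & H4).
assert (Q := is_derive_qdot _ _ _ _ _ (is_qderive_hopf _ _ _ D1) (is_qderive_hopf _ _ _ D1)).
assert (Sp := hopf_speed _ _ U0 (unit_speed_orth _ _ _ _ _ Hg t0 Ht0)).
assert (Pos := Hspeed t0 Ht0). cbv zeta in Sp, Pos.
set (h := qadd (qmul (qmul (qconj (g1 t0)) qi) (g t0))
  (qmul (qmul (qconj (g t0)) qi) (g1 t0))) in *.
assert (h1 : x1 h = 0).
{ unfold h. generalize (g t0) (g1 t0); clear; qring. }
assert (h2 : x2 h = 0).
{ eapply (derive_const_on a b _ t0 c _ Ht0); [|exact H2]. intros u Hu; apply Htorus, Hu. }
assert (h34 : x3 h * p + x4 h * q = 0).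
{ assert (qdot h (hopf (g t0)) + qdot (hopf (g t0)) h = 0).
  { eapply (derive_const_on a b _ t0 1 _ Ht0); [|exact Q].
    intros u Hu. cbv beta. rewrite qdot_hopf. destruct (Htorus u Hu) as [-> _]; ring. }
  rewrite qdot_comm in H. unfold qdot in H. fold p q in H. rewrite h1, h2 in H. lra. }
assert (L : is_derive (fun u => F (g u)) t0 (x3 h * q - x4 h * p)).
{ unfold F; dpoly. ring. }
(* The velocity [h] is tangent to the circle, hence orthogonal to the nonzero vector [(p, q)]. If
   its determinant with [(p, q)] vanished as well, [h] would be zero, against [Hspeed]. *)
assert (L0 : x3 h * q - x4 h * p <> 0).
{ intros Z. unfold qdot in Sp. rewrite h1, h2 in Sp.
  assert ((x3 h * x3 h + x4 h * x4 h) * (p * p + q * q) =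
    (x3 h * q - x4 h * p) * (x3 h * q - x4 h * p) +
    (x3 h * p + x4 h * q) * (x3 h * p + x4 h * q)) as M by ring.
  rewrite Z, h34 in M.
  assert (0 < (x3 h * x3 h + x4 h * x4 h) * (p * p + q * q)); [|lra].
  apply Rmult_lt_0_compat; lra. }
destruct (local_surjectivity a b (fun u => F (g u)) t0 _ d1 Fd Ht0 L L0 Hd1)
  as (e1 & E4 & He1).
exists (Rmin e0 (e1 / 32)); split; [apply Rmin_glb_lt; lra|].
assert (M1 := Rmin_l e0 (e1 / 32)). assert (M2 := Rmin_r e0 (e1 / 32)).
set (e := Rmin e0 (e1 / 32)) in *. clearbody e.
intros y Hy N. destruct (Hy) as [Uy _].
destruct (HF _ _ Uy N) as [F1 F2].
assert (F0 : F (g t0) = 0) by (unfold F; fold p q; ring).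
destruct (He1 (F y)) as (t & T1 & T2 & T3).
{ cbv beta. rewrite F0, Rminus_0_r.
  assert (0 < e1) by lra. eapply Rle_lt_trans; [exact F1|]. lra. }
destruct (Hg t T1) as (_ & _ & Ut & _).
destruct (HF _ _ Ut (Nd1 t T2)) as [_ F3].
destruct (planar_eq (x3 (hopf (g t))) (x4 (hopf (g t))) (x3 (hopf y)) (x4 (hopf y)) p q)
  as [J3 J4].
{ rewrite !(on_torus_hopf c); trivial. now apply Htorus. }
{ exact T3. }
{ lra. }
{ lra. }
assert (J : hopf (g t) = hopf y).
{ apply quat_ext; trivial; [now rewrite !hopf_x1|].
  destruct (Htorus t T1) as [_ ->]. symmetry; apply Hy. }
destruct (qmul_near_one _ _ _ Ut (near_trans _ _ _ _ _ (Nd1 t T2) N)) as [R1 R2].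
apply Rabs_le_between in R1.
assert (R0 : / 2 <= x1 (qmul y (qconj (g t)))) by lra.
assert (R3 : 0 < x1 (qmul y (qconj (g t)))) by lra.
assert (Y := hopf_eq_rot _ _ Ut Uy J R3).
eexists t, _; split; [exact T1|split; [|exact Y]].
apply Hk. unfold Rdiv. rewrite Rabs_mult, Rabs_inv.
rewrite (Rabs_pos_eq (x1 _)) by lra.
apply (Rmult_lt_reg_r (x1 (qmul y (qconj (g t))))); trivial.
rewrite Rmult_assoc, Rinv_l, Rmult_1_r by lra. nra.
Qed.
End LocalTorus.

(** * Clifford tori *)

Lemma isometry_sandwich p q : qdot p p = 1 -> qdot q q = 1 -> isometry_S3 (sandwich p q).
Proof.
intros Hp Hq. repeat split.
- intros x Hx. apply qnorm_1. rewrite qdot_sandwich by trivial. now apply qnorm_1.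
- intros x Hx. exists (sandwich (qconj p) (qconj q) x); split.
  + apply qnorm_1. rewrite qdot_sandwich by now rewrite qdot_conj. now apply qnorm_1.
  + unfold sandwich. rewrite !qmul_assoc, unit_mulr, qmul_1l by trivial.
    now apply qmul_unit_cancelr.
- intros x y _ _. unfold sphere_dist. now rewrite qdot_sandwich.
Qed.

Lemma isometry_conj phi : isometry_S3 phi -> isometry_S3 (fun x => qconj (phi x)).
Proof.
intros (H1 & H2 & H3); repeat split.
- intros x Hx. apply qnorm_1. rewrite qdot_conj. now apply qnorm_1, H1.
- intros x Hx. destruct (H2 (qconj x)) as (y & Hy & E).
  + apply qnorm_1. rewrite qdot_conj. now apply qnorm_1.
  + exists y; split; trivial. rewrite E; apply qconj_conj.
- intros x y Hx Hy. rewrite <- (H3 x y Hx Hy). unfold sphere_dist. now rewrite qdot_conj.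
Qed.

Lemma clifford_torus_ext I J X Y : (forall s t, X s t = Y s t) ->
  is_clifford_torus I J X -> is_clifford_torus I J Y.
Proof.
intros E (S & HS & U & HU & K). exists S; split; trivial. exists U; split; trivial.
intros x. rewrite <- K. unfold surface_image.
split; intros (s & t & Hs & Ht & Ex); exists s, t; repeat split; trivial.
- now rewrite E.
- now rewrite <- E.
Qed.

Lemma near_conj e p q : near e p q -> near e (qconj p) (qconj q).
Proof.
intros (H1 & H2 & H3 & H4). unfold near, qconj; cbn [x1 x2 x3 x4 fst snd].
split4; trivial; rewrite <- Rabs_Ropp;
  match goal with |- Rabs ?u < _ => ring_simplify u end;
  [revert H2|revert H3|revert H4]; intros H; eapply Rle_lt_trans; try exact H;
  apply Req_le; f_equal; ring.
Qed.

Lemma clifford_torus_conj I J f g :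
  is_clifford_torus J I (translation (fun t => qconj (g t)) (fun s => qconj (f s))) ->
  is_clifford_torus I J (translation f g).
Proof.
intros (S & (R1 & R2 & phi & P1 & P2 & P3 & P4 & P5) & U & HU & K).
exists (fun x => S (qconj x)); split.
- exists R1, R2, (fun y => qconj (phi y)). split4; trivial. split; [now apply isometry_conj|].
  intros x. rewrite P5. split; intros (y & Hy & E); exists y; split; trivial.
  + now rewrite E, qconj_conj.
  + now rewrite <- E, qconj_conj.
- exists (fun x => U (qconj x)); split.
  + intros x Hx. apply near_locally.
    destruct (proj1 (near_locally _ _) (HU _ Hx)) as (e & E & He).
    exists e; split; trivial. intros q Hq. now apply He, near_conj.
  + intros x. rewrite <- K. unfold surface_image, translation.
    split.
    * intros (s & t & Hs & Ht & E). exists t, s. rewrite <- E, qconj_mul. auto.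
    * intros (t & s & Ht & Hs & E). exists s, t. rewrite <- qconj_mul in E.
      rewrite <- (qconj_conj x), <- E, qconj_conj. auto.
Qed.

Lemma sandwich_mul a u v : qdot a a = 1 ->
  qmul (sandwich (qconj a) a u) (sandwich (qconj a) a v) = sandwich (qconj a) a (qmul u v).
Proof.
intros H. unfold sandwich. rewrite !qmul_assoc, qmul_unit_cancelr'; trivial.
Qed.

(** Rotations preserve the Euclidean norm, which in R^4 is at least the maximum norm and at most
    twice it; hence the factor 2. *)
Lemma sandwich_near p q e x y : qdot p p = 1 -> qdot q q = 1 -> 0 < e ->
  near (e / 2) x y -> near e (sandwich p q x) (sandwich p q y).
Proof.
intros Hp Hq E (N1 & N2 & N3 & N4).
assert (Z : qdot (sandwich p q (qsub y x)) (sandwich p q (qsub y x)) < e * e).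
{ rewrite qdot_sandwich by trivial.
  apply Rabs_def2 in N1, N2, N3, N4.
  unfold qdot, qsub; cbn [x1 x2 x3 x4 fst snd].
  assert (W : forall u, u < e / 2 /\ - (e / 2) < u -> u * u < e * e / 4) by (intros; nra).
  apply W in N1, N2, N3, N4. lra. }
rewrite <- qsub_sandwich in Z. revert Z.
generalize (sandwich p q x) (sandwich p q y). clear - E. intros u v.
unfold near, qdot, qsub; cbn [x1 x2 x3 x4 fst snd]. intros Z.
assert (W : forall z, z * z < e * e -> Rabs z < e).
{ intros z Hz. rewrite <- (Rabs_pos_eq e) by lra. now apply Rsqr_lt_abs_0. }
assert (Q1 := Rle_0_sqr (x1 v - x1 u)). assert (Q2 := Rle_0_sqr (x2 v - x2 u)).
assert (Q3 := Rle_0_sqr (x3 v - x3 u)). assert (Q4 := Rle_0_sqr (x4 v - x4 u)).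
unfold Rsqr in *. split4; apply W; lra.
Qed.

Lemma rot_0 : rot 0 = qone.
Proof. unfold rot; now rewrite cos_0, sin_0. Qed.

Lemma rot_unit s : qdot (rot s) (rot s) = 1.
Proof. unfold rot; qcbn. assert (H := sin2_cos2 s). unfold Rsqr in H. lra. Qed.

Lemma rot_conj s : qconj (rot s) = rot (- s).
Proof. unfold rot; rewrite cos_neg, sin_neg; qring. Qed.

Lemma rot_qi s : qmul (rot s) qi = qmul qi (rot s).
Proof. unfold rot; qring. Qed.

Lemma rot_plus s t : rot (s + t) = qmul (rot s) (rot t).
Proof. unfold rot; rewrite cos_plus, sin_plus; qring. Qed.

Lemma is_qderive_rot s0 s :
  is_qderive (fun u => rot (u - s0)) s (qmul qi (rot (s - s0))).
Proof.
unfold is_qderive, rot; cbn [x1 x2 x3 x4 fst snd].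
split4.
- auto_derive; trivial. qcbn. unfold Rminus. ring.
- auto_derive; trivial. qcbn. unfold Rminus. ring.
- eapply is_derive_eq; [apply (is_derive_Rconst 0)|qcbn; ring].
- eapply is_derive_eq; [apply (is_derive_Rconst 0)|qcbn; ring].
Qed.

Lemma hopf_mull_rot s y : hopf (qmul (rot s) y) = hopf y.
Proof.
unfold hopf. rewrite qconj_mul, <- (qmul_assoc _ _ qi), rot_conj, rot_qi, <- rot_conj.
rewrite !qmul_assoc, <- (qmul_assoc _ (qconj (rot s)) (rot s)), unit_mull by apply rot_unit.
now rewrite qmul_1r.
Qed.

Lemma on_torus_rot c s y : on_torus c y -> on_torus c (qmul (rot s) y).
Proof.
intros [H1 H2]; split; [rewrite qdot_mull, rot_unit, H1; ring|now rewrite hopf_mull_rot].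
Qed.

Lemma on_torus_standard c y : c * c < 1 ->
  standard_torus (sqrt ((1 + c) / 2)) (sqrt ((1 - c) / 2)) y <-> on_torus c y.
Proof.
intros Hc. unfold standard_torus, on_torus. rewrite hopf_x2.
unfold qdot. rewrite <- !Rsqr_pow2, !Rsqr_sqrt by nra. unfold Rsqr. lra.
Qed.

(** * Surfaces swept by Hopf fibres *)

(** Uniqueness for [f' = f i]: the quotient of [f] by the solution [rot] has zero derivative. *)
Lemma geodesic_rot a b f f1 f2 : unit_speed (ointerval a b) f f1 f2 ->
  (forall s, ointerval a b s -> f1 s = qmul (f s) qi) ->
  forall s s', ointerval a b s -> ointerval a b s' -> f s' = qmul (f s) (rot (s' - s)).
Proof.
intros Hf Hi s s' Hs Hs'.
assert (K : qmul (f s') (qconj (rot (s' - s))) = f s).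
{ transitivity (qmul (f s) (qconj (rot (s - s)))).
  - apply (qconst_on_of_derive a b (fun u => qmul (f u) (qconj (rot (u - s))))); trivial.
    intros u Hu. eapply is_qderive_eq.
    + exact (is_qderive_mul f _ u _ _ (proj1 (Hf u Hu))
        (is_qderive_conj _ _ _ (is_qderive_rot s u))).
    + rewrite Hi by trivial. unfold rot.
      generalize (f u) (cos (u - s)) (sin (u - s)). clear. qring.
  - rewrite Rminus_diag, rot_0. change (qconj qone) with (1, -0, -0, -0).
    rewrite Ropp_0. apply qmul_1r. }
rewrite <- K. now rewrite qmul_unit_cancelr by apply rot_unit.
Qed.

(** With [(w, n, m)] the imaginary coordinates of [S], the left side is the derivative of [n / r].
    Its numerator [n' r^2 - n (n n' + m m')] equals [m (m n' - n m')], where the mean curvature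
    equation applies. *)
Lemma frame_ode r w w' h n n' m m' : 0 < r -> r * r = n * n + m * m ->
  w * w' = - (n * n' + m * m') -> m * n' - n * m' = 2 * w * (r * r) + 2 * h * (r * r) * r ->
  n' * / r + n * (w * w' * / (r * r * r)) = 2 * (h * m + w * (m * / r)).
Proof.
intros Hr H1 H2 H3. rewrite H2.
assert (E : n' * (r * r) - n * (n * n' + m * m') =
  m * (2 * w * (r * r) + 2 * h * (r * r) * r)).
{ rewrite <- H3, H1; ring. }
transitivity ((n' * (r * r) - n * (n * n' + m * m')) / (r * r * r)); [field; lra|].
rewrite E. field. lra.
Qed.

Lemma is_derive_inv_sqrt (w : R -> R) (t w' : R) : is_derive w t w' -> 0 < 1 - w t * w t ->
  let r := sqrt (1 - w t * w t) in
  is_derive (fun u => / sqrt (1 - w u * w u)) t (w t * w' * / (r * r * r)).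
Proof.
intros Hw Hp r. assert (Hr : 0 < r) by now apply sqrt_lt_R0.
auto_derive.
- repeat split; try now exists w'.
  + exact Hp.
  + apply Rgt_not_eq, Hr.
- fold r. change (fun x : R => w x) with w.
  rewrite (is_derive_unique _ _ _ Hw).
  change (sqrt (1 + - (w t * w t))) with r. field. lra.
Qed.

Section Core.
Variables (a b c d : Rbar) (f f1 f2 g g1 g2 : R -> quat) (h : R).
Hypotheses (Hab : Rbar_lt a b) (Hcd : Rbar_lt c d).
Hypothesis Hf : unit_speed (ointerval a b) f f1 f2.
Hypothesis Hg : unit_speed (ointerval c d) g g1 g2.
Hypothesis Hi : forall s, ointerval a b s -> f1 s = qmul (f s) qi.
Hypothesis Hcmc : translation_cmc (ointerval a b) (ointerval c d) f f1 f2 g g1 g2 h.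

(* Here [Tleft] is [i], and [conj g * hopf_axis * g] is [- h p + nu], where [p] is
   the Hopf image of [g] and [nu] the unit normal of the curve [p] in the
   2-sphere: constancy of this vector says that [p] runs on a circle. *)
Definition hopf_axis (t : R) : quat :=
  let S := qmul (g t) (qconj (g1 t)) in
  let k := / sqrt (1 - x2 S * x2 S) in
  (0, - h, x3 S * k, x4 S * k).

Lemma Tright_coords t : ointerval c d t ->
  let S := qmul (g t) (qconj (g1 t)) in
  x1 S = 0 /\ 0 < 1 - x2 S * x2 S /\ 1 - x2 S * x2 S = x3 S * x3 S + x4 S * x4 S.
Proof.
intros Ht S.
assert (S1 : x1 S = 0) by apply (Tright_imaginary _ _ _ _ _ Hg t Ht).
assert (SS : qdot S S = 1) by apply (Tright_unit _ _ _ _ _ Hg t Ht).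
split; [trivial|].
destruct (ointerval_inhabited _ _ Hab) as [s Hs].
destruct (Hcmc s t Hs Ht) as [W _]. fold S in W.
destruct (Hf s Hs) as (_ & _ & U & _).
rewrite (Hi s Hs), qmul_unit_cancell' in W by trivial.
revert W. unfold qdot in *. cbn [x1 x2 x3 x4 fst snd qi]. rewrite S1 in *.
intros W. split; lra.
Qed.

(** The commutator with [S] is what constancy of [conj g * hopf_axis * g] amounts to before
    conjugation by [g]. The first two coordinates vanish on both sides; the other two carry the mean
    curvature equation. *)
Lemma hopf_axis_derive t : ointerval c d t ->
  let S := qmul (g t) (qconj (g1 t)) in
  is_qderive hopf_axis t (qsub (qmul (hopf_axis t) S) (qmul S (hopf_axis t))).
Proof.
intros Ht.
destruct (Tright_coords t Ht) as (S1 & W & N).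
assert (SD : is_qderive (fun t => qmul (g t) (qconj (g1 t))) t
   (qadd (qmul (g1 t) (qconj (g1 t))) (qmul (g t) (qconj (g2 t))))).
{ apply is_qderive_mul; [apply Hg, Ht|apply is_qderive_conj, Hg, Ht]. }
assert (HD := is_derive_qdot _ _ _ _ _ SD SD).
destruct SD as (_ & D2 & D3 & D4).
destruct (ointerval_inhabited _ _ Hab) as [s Hs].
destruct (Hcmc s t Hs Ht) as [_ C].
destruct (Hf s Hs) as (_ & _ & U & _). destruct (Hg t Ht) as (_ & _ & _ & V).
assert (F2 : qmul (qconj (f s)) (f2 s) = qsc (-1) qone).
{ assert (f2 s = qmul (f1 s) qi) as ->.
  { rewrite <- (is_qderive_unique f1 s (f2 s)) by apply Hf, Hs.
    apply is_qderive_unique. eapply is_qderive_ext_loc; [|apply is_qderive_mulr, Hf, Hs].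
    eapply filter_imp; [|exact (ointerval_locally _ _ _ Hs)].
    intros u Hu; symmetry; now apply Hi. }
  rewrite (Hi s Hs), <- qmul_assoc, qmul_unit_cancell' by trivial. qcbn; qsplit; ring. }
rewrite F2, (Hi s Hs), qmul_unit_cancell' in C by trivial.
rewrite qconj_mulr, V, qsc_1 in *.
assert (I2 : qdot (qmul (g t) (qconj (g1 t))) (qadd qone (qmul (g t) (qconj (g2 t)))) = 0).
{ assert (Z := derive_const_on c d _ t 1 _ Ht (fun u Hu => Tright_unit _ _ _ _ _ Hg u Hu) HD).
  cbv beta in Z. rewrite qdot_comm in Z. lra. }
assert (IB : x1 (qmul (g t) (qconj (g2 t))) = -1).
{ rewrite x1_mul_conjr. apply (unit_speed_acc _ _ _ _ _ Hg t Ht). }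
clear HD F2.
unfold hopf_axis at 1.
set (B := qmul (g t) (qconj (g2 t))) in *.
set (S := fun t => qmul (g t) (qconj (g1 t))) in *.
set (r := sqrt (1 - x2 (S t) * x2 (S t))).
assert (Hr : 0 < r) by now apply sqrt_lt_R0.
assert (Hrr : r * r = 1 - x2 (S t) * x2 (S t)) by (apply sqrt_sqrt; now apply Rlt_le).
assert (RD : is_derive (fun u => / sqrt (1 - x2 (S u) * x2 (S u))) t
   (x2 (S t) * x2 B * / (r * r * r))).
{ unfold r. apply (is_derive_inv_sqrt (fun u => x2 (S u))); trivial.
  eapply is_derive_eq; [exact D2|]. unfold qone, qadd; cbn [x1 x2 x3 x4 fst snd]; ring. }
unfold hopf_axis. change (qmul (g t) (qconj (g1 t))) with (S t).
change (qmul (g t) (qconj (g1 t))) with (S t) in C, I2, N, S1, W.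
fold r.
unfold is_qderive; cbn [x1 x2 x3 x4 fst snd].
change (fun u : R => x3 (qmul (g u) (qconj (g1 u)))) with (fun u => x3 (S u)).
revert C I2 D2 D3 D4.
unfold qdot, qone, qadd, qsub, qsc, qi, qmul; cbn [x1 x2 x3 x4 fst snd].
rewrite S1, IB. intros C I2 D2 D3 D4.
assert (C' : x4 (S t) * x3 B - x3 (S t) * x4 B =
  2 * x2 (S t) * (r * r) + 2 * h * (r * r) * r).
{ replace (0 * 0 + 1 * x2 (S t) + 0 * x3 (S t) + 0 * x4 (S t)) with (x2 (S t)) in C by ring.
  replace (1 - x2 (S t) ^ 2) with (r * r) in C by (rewrite Hrr; ring).
  rewrite sqrt_square in C; lra. }
clear C.
split4.
- eapply is_derive_eq; [apply (is_derive_Rconst 0)|]. ring.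
- eapply is_derive_eq; [apply (is_derive_Rconst (- h))|]. ring.
- eapply is_derive_eq; [apply (is_derive_Rmult (fun u => x3 (S u)) _ _ _ _ D3 RD)|]. fold r.
  cbv beta.
  transitivity (x3 B * / r + x3 (S t) * (x2 (S t) * x2 B * / (r * r * r))); [ring|].
  rewrite (frame_ode r (x2 (S t)) (x2 B) h (x3 (S t)) (x3 B) (x4 (S t)) (x4 B)); lra.
- eapply is_derive_eq; [apply (is_derive_Rmult (fun u => x4 (S u)) _ _ _ _ D4 RD)|]. fold r.
  cbv beta.
  transitivity (x4 B * / r + x4 (S t) * (- x2 (S t) * - x2 B * / (r * r * r))); [ring|].
  (* Exchanging the last two coordinates reverses orientation, so [w], [w'] and [h] change sign. *)
  rewrite (frame_ode r (- x2 (S t)) (- x2 B) (- h) (x4 (S t)) (x4 B) (x3 (S t)) (x3 B)); lra.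
Qed.

Definition hopf_circle_axis (t : R) : quat := sandwich (qconj (g t)) (g t) (hopf_axis t).

(** With [g' = - S g] and [A = hopf_axis], the derivative is [conj g * (A' + S A - A S) * g], and
    the bracket is zero by [hopf_axis_derive]. *)
Lemma hopf_circle_axis_const t t' : ointerval c d t -> ointerval c d t' ->
  hopf_circle_axis t = hopf_circle_axis t'.
Proof.
apply qconst_on_of_derive. intros u Hu.
destruct (Hg u Hu) as (D1 & _ & U & _).
destruct (Tright_coords u Hu) as (S1 & _).
assert (HA := hopf_axis_derive u Hu). cbv zeta in HA, S1.
set (S := qmul (g u) (qconj (g1 u))) in *.
assert (E1 : qconj (g1 u) = qmul (qconj (g u)) S) by (unfold S; now rewrite qmul_unit_cancell').
assert (E2 : g1 u = qmul (qsc (-1) S) (g u)).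
{ rewrite <- (qconj_conj (g1 u)), E1, qconj_mul, qconj_conj, (qconj_imag S S1); trivial. }
eapply is_qderive_eq.
- apply is_qderive_mul; [apply is_qderive_mul|exact D1]; [apply is_qderive_conj, D1|exact HA].
- rewrite E1, E2. cbv beta. generalize (g u) (hopf_axis u) S. clear. intros p q r.
  qring.
Qed.

(* Moving the axis of the circle to [i] by [q] puts [g * q] on a standard torus. *)
Lemma clifford_torus_of_hopf_orbit :
  is_clifford_torus (ointerval a b) (ointerval c d) (translation f g).
Proof.
destruct (ointerval_inhabited _ _ Hab) as [s0 Hs0].
destruct (ointerval_inhabited _ _ Hcd) as [t0 Ht0].
(* The axis has length [sqrt (1 + h * h)], by [AU] below; [k] normalizes it. *)
set (k := / sqrt (1 + h * h)).
assert (Kp : 0 < 1 + h * h) by nra.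
assert (Hk : k * k * (1 + h * h) = 1).
{ rewrite <- (sqrt_sqrt (1 + h * h)) by lra. unfold k. field.
  apply Rgt_not_eq, sqrt_lt_R0, Kp. }
clearbody k.
assert (AU : forall t, ointerval c d t -> qdot (hopf_axis t) (hopf_axis t) = 1 + h * h).
{ intros t Ht. destruct (Tright_coords t Ht) as (S1 & W & N). unfold hopf_axis.
  set (S := qmul (g t) (qconj (g1 t))) in *. set (r := sqrt (1 - x2 S * x2 S)).
  assert (Hr : 0 < r) by now apply sqrt_lt_R0.
  assert (Hrr : r * r = 1 - x2 S * x2 S) by (apply sqrt_sqrt; now apply Rlt_le).
  unfold qdot; cbn [x1 x2 x3 x4 fst snd].
  transitivity (h * h + (x3 S * x3 S + x4 S * x4 S) / (r * r)); [field; lra|].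
  rewrite <- N, <- Hrr. field. lra. }
destruct (conj_to_i (qsc k (hopf_circle_axis t0))) as (q & Hq & Eq).
{ unfold hopf_circle_axis. assert (A1 : x1 (hopf_axis t0) = 0) by reflexivity.
  revert A1. unfold sandwich. generalize (g t0) (hopf_axis t0). clear.
  intros [[[y1 y2] y3] y4] [[[u1 u2] u3] u4]. qcbn; intros ->; ring. }
{ destruct (Hg t0 Ht0) as (_ & _ & U & _).
  unfold hopf_circle_axis. rewrite qsc_sandwich, qdot_sandwich by (rewrite ?qdot_conj; trivial).
  transitivity (k * k * qdot (hopf_axis t0) (hopf_axis t0)).
  - generalize (hopf_axis t0); clear; qring.
  - rewrite AU; trivial. }
(* The height of the circle: the Hopf image of [g] and the unit axis are conjugates by [g] of [i]
   and [k * hopf_axis], whose inner product is [- k * h]. *)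
set (C := - k * h).
assert (HC : C * C < 1) by (unfold C; assert (k * k > 0) by nra; lra).
assert (Htor : forall t, ointerval c d t -> on_torus C (qmul (g t) q)).
{ intros t Ht. destruct (Hg t Ht) as (_ & _ & U & _). split.
  - rewrite qdot_mull, U, Hq; ring.
  - transitivity (qdot (hopf (qmul (g t) q)) qi).
    { generalize (hopf (qmul (g t) q)); clear. qring. }
    assert (Eq' : qi = sandwich (qconj q) q (qsc k (hopf_circle_axis t))).
    { rewrite (hopf_circle_axis_const t t0 Ht Ht0). unfold sandwich.
      rewrite <- qmul_assoc, Eq. now rewrite qmul_unit_cancell'. }
    assert (Eh : hopf (qmul (g t) q) = sandwich (qconj q) q (sandwich (qconj (g t)) (g t) qi)).
    { unfold hopf, sandwich. now rewrite qconj_mul, !qmul_assoc. }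
    transitivity (qdot (sandwich (qconj q) q (sandwich (qconj (g t)) (g t) qi))
      (sandwich (qconj q) q (qsc k (hopf_circle_axis t)))); [now rewrite Eh, <- Eq'|].
    unfold hopf_circle_axis.
    rewrite qsc_sandwich, !qdot_sandwich by (rewrite ?qdot_conj; trivial).
    unfold hopf_axis, C; qcbn; ring. }
assert (Hgq : unit_speed (ointerval c d) (fun t => qmul (g t) q) (fun t => qmul (g1 t) q)
  (fun t => qmul (g2 t) q)) by now apply unit_speed_mulr.
assert (Hsp : forall t, ointerval c d t ->
  let S := qmul (qmul (g t) q) (qconj (qmul (g1 t) q)) in 0 < x3 S * x3 S + x4 S * x4 S).
{ intros t Ht. rewrite qconj_mul, !qmul_assoc, qmul_unit_cancelr' by trivial.
  destruct (Tright_coords t Ht) as (_ & W & N). cbv zeta. lra. }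
destruct (Hf s0 Hs0) as (_ & _ & U0 & _).
set (phi := sandwich (f s0) (qconj q)).
assert (Hphi : forall s t, ointerval a b s ->
  translation f g s t = phi (qmul (rot (s - s0)) (qmul (g t) q))).
{ intros s t Hs. unfold translation, phi, sandwich.
  rewrite (geodesic_rot a b f f1 f2 Hf Hi s0 s Hs0 Hs), !qmul_assoc.
  now rewrite qmul_unit_cancelr'. }
set (R1 := sqrt ((1 + C) / 2)). set (R2 := sqrt ((1 - C) / 2)).
assert (HC1 : -1 < C < 1) by nra.
set (S := fun x => exists y, standard_torus R1 R2 y /\ phi y = x).
exists S; split.
{ exists R1, R2, phi. repeat split; try (apply sqrt_lt_R0; lra); try tauto.
  - unfold R1, R2. rewrite !pow2_sqrt; lra.
  - apply isometry_sandwich; now rewrite ?qdot_conj.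
  - apply isometry_sandwich; now rewrite ?qdot_conj.
  - apply isometry_sandwich; now rewrite ?qdot_conj. }
(* The largest candidate: all points near which the torus stays inside the image. It is open by
   construction, and the work lies in showing that it contains the image. *)
exists (fun x => locally x (fun y => S y ->
  surface_image (ointerval a b) (ointerval c d) (translation f g) y)); split.
{ intros x Hx. now apply locally_locally. }
intros x; split.
- intros (s & t & Hs & Ht & <-). split.
  + destruct (Hf s Hs) as (_ & _ & U & _).
    destruct (ointerval_locally _ _ _ Hs) as [e1 He1].
    destruct (torus_local_param _ _ _ _ _ C Hgq HC Htor Hsp t e1 Ht (cond_pos e1))
      as (e & E & He).
    apply near_locally. exists (e / 2). split; [lra|].
    intros x' Nx (y & Hy & <-).
    (* Undoing [f s] on the left and [conj q] on the right moves the base point to [g t * q] on the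
       standard torus, and [phi y] to [rot (s0 - s) * y], so that [torus_local_param] applies. *)
    assert (N := sandwich_near (qconj (f s)) q e _ _ ltac:(now rewrite qdot_conj) Hq E Nx).
    unfold translation in N.
    replace (sandwich (qconj (f s)) q (qmul (f s) (g t))) with (qmul (g t) q) in N
      by (unfold sandwich; now rewrite qmul_unit_cancell').
    replace (sandwich (qconj (f s)) q (phi y)) with (qmul (rot (s0 - s)) y) in N.
    * destruct (He _ (on_torus_rot _ _ _ (proj1 (on_torus_standard C y HC) Hy)) N)
        as (t' & u & Ht' & Hu & E').
      assert (Hsu : ointerval a b (s + u)).
      { apply He1. change (Rabs (s + u - s) < e1). now replace (s + u - s) with u by ring. }
      exists (s + u), t'. repeat split; trivial; try apply Hsu; try apply Ht'.
      rewrite Hphi by trivial. f_equal.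
      replace (s + u - s0) with (- (s0 - s) + u) by ring.
      rewrite rot_plus, <- qmul_assoc, <- E', qmul_assoc, <- rot_conj, unit_mull, qmul_1l;
        trivial; apply rot_unit.
    * unfold phi, sandwich.
      rewrite (geodesic_rot a b f f1 f2 Hf Hi s s0 Hs Hs0), !qmul_assoc, unit_mull, qmul_1l
        by trivial. now rewrite qmul_unit_cancelr.
  + exists (qmul (rot (s - s0)) (qmul (g t) q)); split.
    * apply on_torus_standard, on_torus_rot, Htor; trivial.
    * symmetry; now apply Hphi.
- intros [Ux Sx]. exact (locally_singleton _ _ Ux Sx).
Qed.
End Core.

(** * The three cases *)

(** Inserting [p] and its inverse between the two factors leaves the surface unchanged and
    conjugates [T] and [S] by the same [p]. This is the freedom used to bring [T] to [i]. *)
Lemma translation_cmc_conjugate I J f f1 f2 g g1 g2 h p : qdot p p = 1 ->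
  translation_cmc I J f f1 f2 g g1 g2 h ->
  translation_cmc I J (fun s => qmul (f s) p) (fun s => qmul (f1 s) p) (fun s => qmul (f2 s) p)
    (fun t => qmul (qconj p) (g t)) (fun t => qmul (qconj p) (g1 t))
    (fun t => qmul (qconj p) (g2 t)) h.
Proof.
intros Hp H s t Hs Ht.
assert (E1 : forall u v, qmul (qconj (qmul u p)) (qmul v p) =
  sandwich (qconj p) p (qmul (qconj u) v)).
{ intros u v; unfold sandwich; now rewrite qconj_mul, !qmul_assoc. }
assert (E2 : forall u v, qmul (qmul (qconj p) u) (qconj (qmul (qconj p) v)) =
  sandwich (qconj p) p (qmul u (qconj v))).
{ intros u v; unfold sandwich; now rewrite qconj_mul, qconj_conj, !qmul_assoc. }
cbv zeta. rewrite !E1, !E2, sandwich_mul, qsub_sandwich, !qdot_sandwich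
  by (rewrite ?qdot_conj; trivial).
exact (H s t Hs Ht).
Qed.

(** Conjugation exchanges [T] and [S] together with their derivatives. Both [T' - S'] and [T x S]
    change sign, so [h] stays the same. *)
Lemma translation_cmc_swap a b c d f f1 f2 g g1 g2 h :
  unit_speed (ointerval a b) f f1 f2 -> unit_speed (ointerval c d) g g1 g2 ->
  translation_cmc (ointerval a b) (ointerval c d) f f1 f2 g g1 g2 h ->
  translation_cmc (ointerval c d) (ointerval a b)
    (fun t => qconj (g t)) (fun t => qconj (g1 t)) (fun t => qconj (g2 t))
    (fun s => qconj (f s)) (fun s => qconj (f1 s)) (fun s => qconj (f2 s)) h.
Proof.
intros Hf Hg H t s Ht Hs. cbv zeta. rewrite !qconj_conj.
destruct (H s t Hs Ht) as [W C]. cbv zeta in W, C.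
assert (IT := Tleft_imaginary _ _ _ _ _ Hf s Hs).
assert (IS := Tright_imaginary _ _ _ _ _ Hg t Ht).
assert (IA : x1 (qmul (qconj (f s)) (f2 s)) = -1).
{ rewrite x1_mul_conjl; eapply unit_speed_acc; eassumption. }
assert (IB : x1 (qmul (g t) (qconj (g2 t))) = -1).
{ rewrite x1_mul_conjr; eapply unit_speed_acc; eassumption. }
rewrite (qdot_comm (qmul (g t) (qconj (g1 t)))).
split; [exact W|]. rewrite <- C. f_equal. revert IT IS IA IB.
generalize (qmul (qconj (f s)) (f1 s)) (qmul (g t) (qconj (g1 t)))
  (qmul (qconj (f s)) (f2 s)) (qmul (g t) (qconj (g2 t))). clear.
intros T S A B.
destruct T as [[[T1 T2] T3] T4], S as [[[S1 S2] S3] S4], A as [[[A1 A2] A3] A4],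
  B as [[[B1 B2] B3] B4].
qcbn. intros -> -> -> ->. ring.
Qed.

(** For a geodesic [T' = 1 + conj f * f2] vanishes, so [T] is constant and a single [p] brings it to
    [i] for all [s]. *)
Lemma clifford_torus_geodesic a b c d f f1 f2 g g1 g2 h :
  Rbar_lt a b -> Rbar_lt c d ->
  unit_speed (ointerval a b) f f1 f2 -> unit_speed (ointerval c d) g g1 g2 ->
  translation_cmc (ointerval a b) (ointerval c d) f f1 f2 g g1 g2 h ->
  (forall s, ointerval a b s -> f2 s = qsc (-1) (f s)) ->
  is_clifford_torus (ointerval a b) (ointerval c d) (translation f g).
Proof.
intros Hab Hcd Hf Hg H Hf2.
destruct (ointerval_inhabited _ _ Hab) as [s0 Hs0].
destruct (conj_to_i (qmul (qconj (f s0)) (f1 s0))) as (p & Hp & Ep).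
{ exact (Tleft_imaginary _ _ _ _ _ Hf s0 Hs0). }
{ exact (Tleft_unit _ _ _ _ _ Hf s0 Hs0). }
assert (K : forall s, ointerval a b s ->
  qmul (qconj (f s)) (f1 s) = qmul (qconj (f s0)) (f1 s0)).
{ intros s Hs. apply (qconst_on_of_derive a b (fun u => qmul (qconj (f u)) (f1 u))); trivial.
  intros u Hu. destruct (Hf u Hu) as (D1 & D2 & U & V).
  eapply is_qderive_eq; [apply is_qderive_mul; [apply is_qderive_conj, D1|exact D2]|].
  cbv beta. rewrite Hf2, qconj_mull, V by trivial.
  transitivity (qsc (1 - qdot (f u) (f u)) qone); [generalize (f u); clear; qring|].
  rewrite U. qcbn; qsplit; ring. }
apply (clifford_torus_ext _ _
  (translation (fun s => qmul (f s) p) (fun t => qmul (qconj p) (g t)))).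
- intros s t; unfold translation. now rewrite qmul_assoc, qmul_unit_cancelr'.
- apply (clifford_torus_of_hopf_orbit a b c d _ (fun s => qmul (f1 s) p) (fun s => qmul (f2 s) p) _
    (fun t => qmul (qconj p) (g1 t)) (fun t => qmul (qconj p) (g2 t)) h); trivial.
  + now apply unit_speed_mulr.
  + apply unit_speed_mull; trivial; now rewrite qdot_conj.
  + intros s Hs. destruct (Hf s Hs) as (_ & _ & U & _).
    rewrite <- qmul_assoc, <- Ep, <- (K s Hs), !qmul_assoc, unit_mulr, qmul_1l; trivial.
  + now apply translation_cmc_conjugate.
Qed.

Lemma kappa_geodesic a b g :
  unit_speed (ointerval a b) g (qderive g) (qderive (qderive g)) ->
  (forall s, ointerval a b s -> kappa g s = 0) ->
  forall s, ointerval a b s -> qderive (qderive g) s = qsc (-1) (g s).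
Proof.
intros Hg Hk s Hs. assert (K := Hk s Hs). unfold kappa, qnorm, tan_proj in K.
apply sqrt_eq_0 in K; [|unfold qdot; nra].
apply qdot_0 in K. rewrite minus_qsub, scal_qsc, qdot_comm in K.
rewrite (unit_speed_acc _ _ _ _ _ Hg s Hs) in K. revert K.
generalize (qderive (qderive g) s) (g s). clear.
intros [[[u1 u2] u3] u4] [[[v1 v2] v3] v4]. qcbn. intros K; injection K; intros.
qsplit; lra.
Qed.

(** Parseval's identity in the orthogonal frame [T], [U], [T x U] of the imaginary quaternions, with
    the denominators [|T|^2] and [|U|^2] cleared. *)
Lemma frame_parseval T U x y : x1 T = 0 -> x1 U = 0 -> x1 x = 0 -> x1 y = 0 ->
  qdot T U = 0 ->
  qdot x y * (qdot T T * qdot U U) =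
  qdot x T * qdot y T * qdot U U + qdot x U * qdot y U * qdot T T
  + qdot x (vprod qone T U) * qdot y (vprod qone T U).
Proof.
intros HT HU Hx Hy H.
transitivity (qdot x T * qdot y T * qdot U U + qdot x U * qdot y U * qdot T T
  + qdot x (vprod qone T U) * qdot y (vprod qone T U)
  + qdot T U * (qdot x y * qdot T U - qdot x T * qdot y U - qdot x U * qdot y T)).
- clear H. destruct T as [[[T1 T2] T3] T4], U as [[[S1 S2] S3] S4], x as [[[A1 A2] A3] A4],
  y as [[[B1 B2] B3] B4]. qcbn. subst. ring.
- rewrite H; ring.
Qed.

(** [U] and [V] stand for [T'] and [S']. If [U] is nonzero, then [V], orthogonal to [T] and [U], is
    a multiple of [T x U]. The component [m] of [S] in that direction satisfies
    [m^2 = (1 - C^2) |U|^2], which is positive because [|C| < 1]; so [<S, V> = 0] forces [V = 0]. *)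
Lemma constant_angle_rigid T U S V C : x1 T = 0 -> x1 U = 0 -> x1 S = 0 -> x1 V = 0 ->
  qdot T T = 1 -> qdot T U = 0 -> qdot S S = 1 -> qdot S V = 0 ->
  -1 < C < 1 -> qdot T S = C -> qdot U S = 0 -> qdot T V = 0 -> qdot U V = 0 ->
  U = (0, 0, 0, 0) \/ V = (0, 0, 0, 0).
Proof.
intros T1 U1 S1 V1 TT TU SS SV HC TS US TV UV.
destruct (Req_dec (qdot U U) 0) as [Z|Z]; [left; now apply qdot_0|right].
assert (Up : 0 < qdot U U) by (assert (Q := qdot_ge_0 U); lra).
assert (P1 := frame_parseval T U S V T1 U1 S1 V1 TU).
assert (P2 := frame_parseval T U S S T1 U1 S1 S1 TU).
assert (P3 := frame_parseval T U V V T1 U1 V1 V1 TU).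
rewrite !(qdot_comm S T), !(qdot_comm S U), !(qdot_comm V T), !(qdot_comm V U) in *.
rewrite TT, SS, SV, TS, US, TV, UV in *.
set (m := qdot S (vprod qone T U)) in *. set (n := qdot V (vprod qone T U)) in *.
assert (Hm : m <> 0).
{ intros E. rewrite E in P2. assert (0 < (1 - C * C) * qdot U U); [|lra].
  apply Rmult_lt_0_compat; [nra|trivial]. }
assert (Hn : n = 0) by (destruct (Rmult_integral m n) as [E|E]; [lra|contradiction|trivial]).
rewrite Hn in P3. apply qdot_0.
destruct (Rmult_integral (qdot V V) (qdot U U)); [lra|trivial|contradiction].
Qed.

Lemma qadd_one_geodesic f f2 : qdot f f = 1 ->
  qadd qone (qmul (qconj f) f2) = (0, 0, 0, 0) -> f2 = qsc (-1) f.
Proof.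
intros U E. rewrite <- (qmul_unit_cancell f f2 U).
replace (qmul (qconj f) f2) with (qsc (-1) qone).
- generalize f; clear; qring.
- revert E. generalize (qmul (qconj f) f2). clear. intros [[[u1 u2] u3] u4].
  qcbn. intros K; injection K; intros. qsplit; lra.
Qed.

Lemma constant_angle_geodesic a b c d f f1 f2 g g1 g2 C :
  unit_speed (ointerval a b) f f1 f2 -> unit_speed (ointerval c d) g g1 g2 ->
  -1 < C < 1 ->
  (forall s t, ointerval a b s -> ointerval c d t ->
    qdot (qmul (qconj (f s)) (f1 s)) (qmul (g t) (qconj (g1 t))) = C) ->
  (forall s, ointerval a b s -> f2 s = qsc (-1) (f s)) \/
  (forall t, ointerval c d t -> g2 t = qsc (-1) (g t)).
Proof.
intros Hf Hg HC H.
destruct (classic (forall s, ointerval a b s -> f2 s = qsc (-1) (f s))) as [N|N]; [now left|right].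
intros t Ht.
apply not_all_ex_not in N. destruct N as [s N]. apply imply_to_and in N. destruct N as [Hs N].
set (T := fun u => qmul (qconj (f u)) (f1 u)). set (S := fun u => qmul (g u) (qconj (g1 u))).
set (T' := fun u => qadd qone (qmul (qconj (f u)) (f2 u))).
set (S' := fun u => qadd qone (qmul (g u) (qconj (g2 u)))).
destruct (Hf s Hs) as (_ & _ & Us & _). destruct (Hg t Ht) as (_ & _ & Ut & _).
assert (DT : forall u, ointerval a b u -> is_qderive T u (T' u)).
{ intros u Hu. destruct (Hf u Hu) as (D1 & D2 & _ & V).
  eapply is_qderive_eq; [apply is_qderive_mul; [apply is_qderive_conj, D1|exact D2]|].
  cbv beta. now rewrite qconj_mull, V, qsc_1. }
assert (DS : forall u, ointerval c d u -> is_qderive S u (S' u)).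
{ intros u Hu. destruct (Hg u Hu) as (D1 & D2 & _ & V).
  eapply is_qderive_eq; [apply is_qderive_mul; [exact D1|apply is_qderive_conj, D2]|].
  cbv beta. now rewrite qconj_mulr, V, qsc_1. }
assert (IT := fun u Hu => Tleft_imaginary _ _ _ _ _ Hf u Hu).
assert (IS := fun u Hu => Tright_imaginary _ _ _ _ _ Hg u Hu).
assert (UT := fun u Hu => Tleft_unit _ _ _ _ _ Hf u Hu).
assert (US := fun u Hu => Tright_unit _ _ _ _ _ Hg u Hu).
(* This is stated for all [u], not just [s], because differentiating it again at [s] yields
   [<T', S'> = 0]. *)
assert (TS' : forall u, ointerval a b u -> qdot (T u) (S' t) = 0).
{ intros u Hu. eapply (derive_const_on c d (fun v => qdot (T u) (S v)) t C _ Ht).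
  - intros v Hv. now apply H.
  - eapply is_derive_eq; [apply is_derive_qdot; [apply is_qderive_const|apply DS, Ht]|].
    generalize (T u) (S t) (S' t). clear. qring. }
destruct (constant_angle_rigid (T s) (T' s) (S t) (S' t) C) as [Z|Z]; trivial.
- now apply IT.
- unfold T', qadd; cbn [x1 fst]. rewrite x1_mul_conjl, (unit_speed_acc _ _ _ _ _ Hf s Hs).
  cbn; ring.
- now apply IS.
- unfold S', qadd; cbn [x1 fst]. rewrite x1_mul_conjr, (unit_speed_acc _ _ _ _ _ Hg t Ht).
  cbn; ring.
- now apply UT.
- assert (2 * qdot (T s) (T' s) = 0); [|lra].
  eapply (derive_const_on a b (fun v => qdot (T v) (T v)) s 1 _ Hs).
  + intros v Hv. now apply UT.
  + eapply is_derive_eq; [apply is_derive_qdot; apply DT, Hs|].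
    rewrite (qdot_comm (T' s)); ring.
- now apply US.
- assert (2 * qdot (S t) (S' t) = 0); [|lra].
  eapply (derive_const_on c d (fun v => qdot (S v) (S v)) t 1 _ Ht).
  + intros v Hv. now apply US.
  + eapply is_derive_eq; [apply is_derive_qdot; apply DS, Ht|].
    rewrite (qdot_comm (S' t)); ring.
- now apply H.
- eapply (derive_const_on a b (fun v => qdot (T v) (S t)) s C _ Hs).
  + intros v Hv. now apply H.
  + eapply is_derive_eq; [apply is_derive_qdot; [apply DT, Hs|apply is_qderive_const]|].
    generalize (T s) (S t) (T' s). clear. qring.
- now apply TS'.
- eapply (derive_const_on a b (fun v => qdot (T v) (S' t)) s 0 _ Hs).
  + exact TS'.
  + eapply is_derive_eq; [apply is_derive_qdot; [apply DT, Hs|apply is_qderive_const]|].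
    generalize (T s) (S' t) (T' s). clear. qring.
- exfalso. apply N. now apply qadd_one_geodesic.
- rewrite <- (qconj_conj (g2 t)).
  rewrite (qadd_one_geodesic (qconj (g t)) (qconj (g2 t))).
  + generalize (g t); clear; qring.
  + now rewrite qdot_conj.
  + now rewrite qconj_conj.
Qed.

Theorem theorem4p2 (a b c d : Rbar) (alpha beta : R -> quat)
  (Hab : Rbar_lt a b) (Hcd : Rbar_lt c d)
  (Halpha : arc_length_curve (ointerval a b) alpha)
  (Hbeta : arc_length_curve (ointerval c d) beta)
  (Hreg : regular_on (ointerval a b) (ointerval c d) (translation alpha beta))
  (HH : constant_mean_curvature (ointerval a b) (ointerval c d)
          (translation alpha beta))
  (Hcase :
    (exists C : R, -1 < C < 1 /\
       forall s t : R, ointerval a b s -> ointerval c d t ->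
         qdot (Tleft alpha s) (Tright beta t) = C)
    \/ (forall s : R, ointerval a b s -> kappa alpha s = 0)
    \/ (forall t : R, ointerval c d t -> kappa beta t = 0)) :
  is_clifford_torus (ointerval a b) (ointerval c d) (translation alpha beta).
Proof.
assert (Ha := arc_length_unit_speed _ _ Halpha).
assert (Hb := arc_length_unit_speed _ _ Hbeta).
destruct HH as [H HH].
assert (CMC : translation_cmc (ointerval a b) (ointerval c d)
  alpha (qderive alpha) (qderive (qderive alpha))
  beta (qderive beta) (qderive (qderive beta)) (- H)).
{ intros s t Hs Ht T S w.
  assert (W : w ^ 2 < 1).
  { eapply translation_regular; eassumption. }
  split; [exact W|]. rewrite <- (HH s t Hs Ht).
  exact (mean_curvature_translation _ _ _ _ _ _ _ _ _ _ Ha Hb s t Hs Ht W). }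
assert (G : (forall s, ointerval a b s -> qderive (qderive alpha) s = qsc (-1) (alpha s)) \/
  (forall t, ointerval c d t -> qderive (qderive beta) t = qsc (-1) (beta t))).
{ destruct Hcase as [(C & HC & K)|[K|K]].
  - exact (constant_angle_geodesic _ _ _ _ _ _ _ _ _ _ C Ha Hb HC K).
  - left. now apply (kappa_geodesic a b).
  - right. now apply (kappa_geodesic c d). }
destruct G as [G|G].
- eapply clifford_torus_geodesic; eassumption.
- apply clifford_torus_conj.
  eapply clifford_torus_geodesic; [exact Hcd|exact Hab| | | |].
  + apply unit_speed_conj, Hb.
  + apply unit_speed_conj, Ha.
  + apply translation_cmc_swap; eassumption.
  + intros t Ht. cbv beta. rewrite G by trivial. generalize (beta t); clear; qring.
Qed.
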